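(* Let $(H,\Delta_H)$ be a compact quantum group. Suppose there are a nontrivial compact quantum group $(K,\Delta)$ whose underlying $C^*$-algebra $K$ is finite-dimensional and an embedding $K \hookrightarrow H$ of compact quantum groups. Then for every nonzero unital $C^*$-algebra $A$ and every free coaction $\delta: A \to A \otimes H$ of $(H,\Delta_H)$, there does not exist a $(\Delta_H, \delta_{\Delta_H})$-equivariant unital $*$-homomorphism $H \to A \circledast_\delta H$.
   Context: $\otimes$ denotes the minimal tensor product of $C^*$-algebras. A compact quantum group $(H,\Delta)$ is a unital $C^*$-algebra $H$ with an injective unital coassociative $*$-homomorphism $\Delta:H\to H\otimes H$ such that the linear spans of $(H\otimes 1)\Delta(H)$ and $(1\otimes H)\Delta(H)$ are dense in $H\otimes H$. It is nontrivial if $H\neq\mathbb{C}$. An embedding of compact quantum groups $K\hookrightarrow H$ is an injective unital $*$-homomorphism $\iota$ intertwining comultiplications: $\Delta_H\circ\iota=(\iota\otimes\iota)\circ\Delta_K$. A coaction of $(H,\Delta)$ on a unital $C^*$-algebra $A$ is an injective unital $*$-homomorphism $\delta:A\to A\otimes H$ with $(\delta\otimes\mathrm{id})\circ\delta=(\mathrm{id}\otimes\Delta)\circ\delta$ and with the linear span of $\delta(A)(1\otimes H)$ dense in $A\otimes H$. It is free if the set of finite sums $\sum_i (a_i \otimes 1)\delta(b_i)$, with $a_i, b_i \in A$, is dense in $A \otimes H$. The equivariant noncommutative join of $A$ and $H$ is $$A \circledast_\delta H = \{f \in \mathcal{C}([0,1], A\otimes H) : f(0)\in \mathbb{C} \otimes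 H,\ f(1)\in \delta(A)\}.$$ It carries a coaction $\delta_\Delta$ of $(H,\Delta)$ given by applying $\mathrm{id}_A\otimes\Delta$ at each $t\in[0,1]$. For $C^*$-algebras $A,B$ with coactions $\delta_A,\delta_B$ of $(H,\Delta)$, a $*$-homomorphism $\phi:A\to B$ is $(\delta_A,\delta_B)$-equivariant if $\delta_B\circ\phi=(\phi\otimes\mathrm{id}_H)\circ\delta_A$. *)

(* Defs.v *)
From HB Require Import structures.
From mathcomp Require Import all_boot all_order all_algebra.
From mathcomp Require Import complex.
From mathcomp Require Import all_classical all_reals all_analysis.
Import Order.TTheory GRing.Theory Num.Theory.
Import numFieldNormedType.Exports.

Set Implicit Arguments.
Unset Strict Implicit.
Unset Printing Implicit Defensive.

Local Open Scope classical_set_scope.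
Local Open Scope ring_scope.
Local Open Scope complex_scope.

(* Unital C*-algebras over R[i], the zero algebra allowed.  The norm takes its
   (real, nonnegative) values in R[i], as always for a normedModType over R[i].
   The multiplication is not inherited from algType because Hierarchy Builder
   admits no structure joining rings and norms besides those below
   numDomainType. *)
HB.mixin Record isCStarAlgebra (R : realType) A
    of CompleteNormedModule R[i] A := {
  cmul : A -> A -> A;
  cone : A;
  star : A -> A;
  cmulA : forall x y z, cmul x (cmul y z) = cmul (cmul x y) z;
  cmul1l : forall x, cmul cone x = x;
  cmul1r : forall x, cmul x cone = x;
  cmulDl : forall x y z, cmul (x + y) z = cmul x z + cmul y z;
  cmulDr : forall x y z, cmul x (y + z) = cmul x y + cmul x z;
  cmulZl : forall (c : R[i]) x y, cmul (c *: x) y = c *: cmul x y;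
  cmulZr : forall (c : R[i]) x y, cmul x (c *: y) = c *: cmul x y;
  starD : forall x y, star (x + y) = star x + star y;
  starZ : forall (c : R[i]) x, star (c *: x) = Num.conj c *: star x;
  starM : forall x y, star (cmul x y) = cmul (star y) (star x);
  starK : forall x, star (star x) = x;
  ler_norm_cmul : forall x y, `|cmul x y| <= `|x| * `|y|;
  norm_starM : forall x, `|cmul (star x) x| = `|x| ^+ 2
}.

#[short(type="cstarType")]
HB.structure Definition CStarAlgebra (R : realType) :=
  {A of CompleteNormedModule R[i] A & isCStarAlgebra R A}.

Notation "x ∙ y" := (cmul x y) (at level 40, left associativity).
Notation "'𝟏'" := cone (at level 0).

(* Unital *-homomorphisms. *)
HB.mixin Record isStarMorphism (R : realType) (A B : cstarType R)
    (f : A -> B) := {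
  star_morphM : forall x y, f (x ∙ y) = f x ∙ f y;
  star_morph1 : f 𝟏 = 𝟏;
  star_morph_star : forall x, f (star x) = star (f x)
}.

HB.structure Definition StarMorphism (R : realType) (A B : cstarType R) :=
  {f of @GRing.Linear R[i] A B *:%R f & @isStarMorphism R A B f}.

Notation "{ 'starmorphism' A -> B }" := (StarMorphism.type A%type B%type)
  (at level 0, A at level 98, B at level 99,
   format "{ 'starmorphism'  A  ->  B }") : type_scope.

Definition lin_span (R : realType) (V : lmodType R[i]) (S : set V) : set V :=
  [set v | exists n (c : 'I_n -> R[i]) (s : 'I_n -> V),
     (forall i, S (s i)) /\ v = \sum_(i < n) c i *: s i].

Definition finite_dimensional (R : realType) (V : lmodType R[i]) : Prop :=
  exists n (e : 'I_n -> V),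
    forall v, exists c : 'I_n -> R[i], v = \sum_(i < n) c i *: e i.

(* A is not the algebra of complex numbers: the only unital homomorphism
   c |-> c *: 1 from R[i] to A is not an isomorphism. *)
Definition nontrivial (R : realType) (A : cstarType R) : Prop :=
  ~ bijective (fun c : R[i] => c *: 𝟏 : A).

Record hilbertSpace (R : realType) := HilbertSpace {
  hilbert_sort :> completeNormedModType R[i];
  hdot : {dot hilbert_sort for Num.conj};
  hdot_norm : forall x, hdot x x = `|x| ^+ 2
}.

(* G is the Hilbert space tensor product of E and F, via tau. *)
Definition hilbert_tensor (R : realType) (E F G : hilbertSpace R)
    (tau : {bilinear E -> F -> G}) : Prop :=
  (forall x x' y y',
     hdot G (tau x y) (tau x' y') = hdot E x x' * hdot F y y') /\
  dense (lin_span [set z | exists x y, z = tau x y]).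

(* act a is the bounded operator on E by which a acts. *)
Definition faithful_representation (R : realType) (A : cstarType R)
    (E : hilbertSpace R) (act : {bilinear A -> E -> E}) : Prop :=
  [/\ (forall a, continuous (act a)),
      (forall a b x, act (a ∙ b) x = act a (act b x)),
      (forall x, act 𝟏 x = x),
      (forall a x y, hdot E (act a x) y = hdot E x (act (star a) y)) &
      (forall a, (forall x, act a x = 0) -> a = 0)].

(* A minimal (spatial) tensor product of A and B: a C*-algebra containing the
   algebraic tensor product as a dense *-subalgebra, with the norm of the
   operators pi(a) (x) sigma(b) on E (x) F, where pi and sigma are faithful
   representations of A and B on Hilbert spaces E and F.  Faithful
   representations of C*-algebras being isometric, the latter says that these
   operators extend to a faithful representation of the tensor product.  This
   determines the tensor product up to a unique isomorphism. *)
Record minTensor (R : realType) (A B : cstarType R) := MinTensor {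
  mintensor_sort :> cstarType R;
  tens : {bilinear A -> B -> mintensor_sort};
  tens11 : tens 𝟏 𝟏 = 𝟏;
  tensM : forall a a' b b', tens a b ∙ tens a' b' = tens (a ∙ a') (b ∙ b');
  tens_star : forall a b, star (tens a b) = tens (star a) (star b);
  tens_dense : dense (lin_span [set x | exists a b, x = tens a b]);
  tens_spatial : exists (E F G : hilbertSpace R)
      (pi : {bilinear A -> E -> E}) (sigma : {bilinear B -> F -> F})
      (rho : {bilinear mintensor_sort -> G -> G}) (tau : {bilinear E -> F -> G}),
    [/\ faithful_representation pi, faithful_representation sigma,
        hilbert_tensor tau, faithful_representation rho &
        forall a b x y, rho (tens a b) (tau x y) = tau (pi a x) (sigma b y)]
}.

Notation "a \ox b" := (tens _ a b) (at level 40, left associativity).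

Section QuantumGroups.
Context (R : realType).
(* A choice of minimal tensor products. *)
Context (mt : forall A B : cstarType R, minTensor A B).
Local Notation "A ⊗ B" := (mt A B) (at level 40, left associativity).

(* F = f (x) g; by density there is at most one such F. *)
Definition is_tensor_map (A B C D : cstarType R) (f : A -> C) (g : B -> D)
    (F : {starmorphism A ⊗ B -> C ⊗ D}) : Prop :=
  forall a b, F (a \ox b) = f a \ox g b.

(* The canonical identification of the two triple tensor products. *)
Definition is_associator (A B C : cstarType R)
    (alpha : {starmorphism (A ⊗ B) ⊗ C -> A ⊗ (B ⊗ C)}) : Prop :=
  forall a b c, alpha ((a \ox b) \ox c) = a \ox (b \ox c).

(* (delta (x) id) o delta = (id (x) Delta) o delta; for delta = Delta, this is
   the coassociativity of Delta. *)
Definition coassociative (A H : cstarType R)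
    (Delta : {starmorphism H -> H ⊗ H})
    (delta : {starmorphism A -> A ⊗ H}) : Prop :=
  exists (F : {starmorphism A ⊗ H -> (A ⊗ H) ⊗ H})
         (G : {starmorphism A ⊗ H -> A ⊗ (H ⊗ H)})
         (alpha : {starmorphism (A ⊗ H) ⊗ H -> A ⊗ (H ⊗ H)}),
    [/\ is_tensor_map delta id F, is_tensor_map id Delta G,
        is_associator alpha &
        forall a, alpha (F (delta a)) = G (delta a)].

Definition compact_quantum_group (H : cstarType R)
    (Delta : {starmorphism H -> H ⊗ H}) : Prop :=
  [/\ injective Delta, coassociative Delta Delta,
      dense (lin_span [set x : H ⊗ H | exists h k, x = (h \ox 𝟏) ∙ Delta k]) &
      dense (lin_span [set x : H ⊗ H | exists h k, x = (𝟏 \ox h) ∙ Delta k])].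

Definition quantum_group_embedding (K H : cstarType R)
    (DeltaK : {starmorphism K -> K ⊗ K}) (DeltaH : {starmorphism H -> H ⊗ H})
    (iota : {starmorphism K -> H}) : Prop :=
  injective iota /\
  exists2 F : {starmorphism K ⊗ K -> H ⊗ H}, is_tensor_map iota iota F &
    forall k, DeltaH (iota k) = F (DeltaK k).

Definition coaction (A H : cstarType R) (Delta : {starmorphism H -> H ⊗ H})
    (delta : {starmorphism A -> A ⊗ H}) : Prop :=
  [/\ injective delta, coassociative Delta delta &
      dense (lin_span [set x : A ⊗ H | exists a h, x = delta a ∙ (𝟏 \ox h)])].

Definition free_coaction (A H : cstarType R)
    (Delta : {starmorphism H -> H ⊗ H})
    (delta : {starmorphism A -> A ⊗ H}) : Prop :=
  coaction Delta delta /\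
  dense [set x : A ⊗ H | exists n (a b : 'I_n -> A),
           x = \sum_(i < n) (a i \ox 𝟏) ∙ delta (b i)].

Definition equivariant (A B H : cstarType R)
    (deltaA : {starmorphism A -> A ⊗ H}) (deltaB : {starmorphism B -> B ⊗ H})
    (phi : {starmorphism A -> B}) : Prop :=
  exists2 F : {starmorphism A ⊗ H -> B ⊗ H}, is_tensor_map phi id F &
    forall a, deltaB (phi a) = F (deltaA a).

(* The elements of the equivariant join, as functions that matter only on
   [0, 1]. *)
Definition join_path (A H : cstarType R) (delta : {starmorphism A -> A ⊗ H})
    (f : R -> A ⊗ H) : Prop :=
  [/\ {within `[0, 1], continuous f},
      exists h, f 0 = 𝟏 \ox h &
      exists a, f 1 = delta a].

(* The equivariant join as a C*-algebra: a C*-algebra identified by its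
   evaluations at t in [0, 1] with the *-algebra of the paths above under
   pointwise operations.  Its norm is the supremum norm, because a *-algebra
   has at most one complete C*-norm. *)
Record equivariantJoin (A H : cstarType R)
    (delta : {starmorphism A -> A ⊗ H}) := EquivariantJoin {
  join_sort :> cstarType R;
  join_ev : R -> {starmorphism join_sort -> A ⊗ H};
  join_ev_path : forall u, join_path delta (join_ev ^~ u);
  join_ev_inj : forall u v,
    {in `[0, 1], forall t, join_ev t u = join_ev t v} -> u = v;
  join_ev_surj : forall f, join_path delta f ->
    exists u, {in `[0, 1], forall t, join_ev t u = f t}
}.

(* deltaJ applies id_A (x) Delta at each t in [0, 1]:
   (ev_t (x) id) o deltaJ = (id_A (x) Delta) o ev_t. *)
Definition is_join_coaction (A H : cstarType R)
    (Delta : {starmorphism H -> H ⊗ H}) (delta : {starmorphism A -> A ⊗ H})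
    (J : equivariantJoin delta) (deltaJ : {starmorphism J -> J ⊗ H}) : Prop :=
  {in `[0, 1], forall t,
    exists (F : {starmorphism J ⊗ H -> (A ⊗ H) ⊗ H})
           (G : {starmorphism A ⊗ H -> A ⊗ (H ⊗ H)})
           (alpha : {starmorphism (A ⊗ H) ⊗ H -> A ⊗ (H ⊗ H)}),
      [/\ is_tensor_map (join_ev J t) id F, is_tensor_map id Delta G,
          is_associator alpha &
          forall u, alpha (F (deltaJ u)) = G (join_ev J t u)]}.

End QuantumGroups.

(* Main.v *)
(* Let [phi_t] be the evaluation at [t] of an equivariant map, restricted to the
   finite quantum group [K].  Classically [phi_t] is determined by its slice
   [Psi_t] at the counit, a path of unital *-homomorphisms from [K] to [A].  Here
   [Psi_t] is obtained by solving [phi_t k = sum Psi_t (k_1) (1 (x) k_2)], which is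
   possible because the matrix of coefficients of the coproduct of [K] is
   invertible; equivariance puts [Psi_t] among the fixed points of
   [id (x) Delta], which are [A (x) 1] because translation on a compact quantum
   group is ergodic (an averaging argument in the style of the construction of the
   Haar state).

   At [t = 0], [Psi_0] is scalar, that is, a character [chi].  A path of
   *-homomorphisms of a finite-dimensional C*-algebra starting at a character is
   constant, since for self-adjoint [k] in the kernel of [chi] the norm of
   [Psi_t k] has a gap above [0].  So [Psi_1 = chi], and being in the image of
   [delta] forces [(chi (x) id) Delta k = chi k] on [K].  By the density of
   [(K (x) 1) Delta K], [K] is then one-dimensional. *)
Require Import Defs.
From HB Require Import structures.
From mathcomp Require Import all_boot all_order all_algebra.
From mathcomp Require Import complex.
From mathcomp Require Import all_classical all_reals all_analysis.
From mathcomp Require Import ring lra.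
Import Order.TTheory GRing.Theory Num.Theory.
Import numFieldNormedType.Exports.

Set Implicit Arguments.
Unset Strict Implicit.
Unset Printing Implicit Defensive.

Local Open Scope classical_set_scope.
Local Open Scope ring_scope.
Local Open Scope complex_scope.

(** * Real-valued norms *)

(** The minimal tensor product is reached only through slice maps. Their boundedness rests on
    faithful representations being isometric, and square roots in the algebra do the work of
    spectral theory there: a self-adjoint [b] is bounded by completing its square with a commuting
    one to a scalar.

    Neither a counit nor a Haar state is at hand. The counit is replaced by a left inverse of the
    matrix of coefficients of the coproduct of [K], obtained by a dimension count. It does not
    depend on [t], so continuity and bounds pass from [phi_t] to [Psi_t]. The Haar state is replaced
    by means of iterated convolution with a vector state, with errors of order [1/N]; no limit
    functional is formed. The outcome is that every vector state is multiplicative at an invariant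
    element, so that every vector is an eigenvector of it.

    At [t = 1] the coaction identity makes [(chi (x) id) Delta k] invariant on the left; expanding
    this in the coefficients of the coproduct and cancelling gives
    [(chi (x) id) Delta k = chi k]. *)

Definition nrm (R : realType) (V : normedModType R[i]) (x : V) : R :=
  complex.Re `|x|.

Section RealNorm.
Context (R : realType) (V : normedModType R[i]).
Implicit Types (x y : V) (c : R[i]).

Lemma nrmE x : `|x| = (nrm x)%:C.
Proof. by rewrite /nrm RRe_real // normr_real. Qed.

Lemma nrm_ge0 x : 0 <= nrm x.
Proof. by rewrite -lecR -nrmE normr_ge0. Qed.

Lemma nrm0 : nrm (0 : V) = 0.
Proof. by rewrite /nrm normr0. Qed.

Lemma nrm0_eq0 x : nrm x = 0 -> x = 0.
Proof. by move=> x0; apply/normr0_eq0; rewrite nrmE x0. Qed.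

Lemma nrm_le0 x : nrm x <= 0 -> x = 0.
Proof. by move=> x0; apply: nrm0_eq0; apply/eqP; rewrite eq_le x0 nrm_ge0. Qed.

Lemma nrm_gt0 x : x <> 0 -> 0 < nrm x.
Proof.
by move=> x0; rewrite lt_def nrm_ge0 andbT; apply/eqP => /nrm0_eq0.
Qed.

Lemma nrmN x : nrm (- x) = nrm x.
Proof. by rewrite /nrm normrN. Qed.

Lemma nrmBC x y : nrm (x - y) = nrm (y - x).
Proof. by rewrite -nrmN opprB. Qed.

Lemma ler_nrmD x y : nrm (x + y) <= nrm x + nrm y.
Proof. by rewrite -lecR rmorphD /= -!nrmE ler_normD. Qed.

Lemma ler_nrmB x y : nrm (x - y) <= nrm x + nrm y.
Proof. by rewrite -(nrmN y) ler_nrmD. Qed.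

Lemma ler_nrm_dist y x z : nrm (x - z) <= nrm (x - y) + nrm (y - z).
Proof. by apply: le_trans (ler_nrmD _ _); rewrite addrA subrK. Qed.

Lemma nrmZ c x : nrm (c *: x) = complex.Re `|c| * nrm x.
Proof.
have cr : `|c| = (complex.Re `|c|)%:C by rewrite RRe_real // normr_real.
by rewrite /nrm normrZ {1}cr (nrmE x) -rmorphM.
Qed.

Lemma nrmZR (t : R) x : nrm (t%:C *: x) = `|t| * nrm x.
Proof. by rewrite nrmZ normc_def /= expr0n /= addr0 sqrtr_sqr. Qed.

Lemma ler_nrm_sum (I : Type) (r : seq I) (P : pred I) (F : I -> V) :
  nrm (\sum_(i <- r | P i) F i) <= \sum_(i <- r | P i) nrm (F i).
Proof.
elim/big_ind2: _ => //; first by rewrite nrm0.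
by move=> x a y b xa yb; apply: (le_trans (ler_nrmD _ _)); rewrite lerD.
Qed.

Lemma dense_nrm (S : set V) : dense S ->
  forall x (e : R), 0 < e -> exists2 y, S y & nrm (x - y) < e.
Proof.
move=> dS x e e0.
have eC : 0 < e%:C by rewrite ltcR.
have [|y [/= xy Sy]] := dS (ball x e%:C) _ (ball_open _ _).
  by exists x; apply: ballxx.
exists y => //; move: xy.
by rewrite -ball_normE /ball_ /= nrmE ltcR.
Qed.

Lemma nrm_dense (S : set V) :
  (forall x (e : R), 0 < e -> exists2 y, S y & nrm (x - y) < e) -> dense S.
Proof.
move=> H O [x Ox] oO.
have /nbhs_ballP[e /= e0 eO] : nbhs x O by exact: open_nbhs_nbhs.
have e0' : 0 < complex.Re e by move: e0; rewrite ltcE => /andP[].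
have [y Sy xy] := H x _ e0'; exists y; split => //; apply: eO.
rewrite -ball_normE /ball_ /= nrmE.
have -> : e = (complex.Re e)%:C by rewrite RRe_real // gtr0_real.
by rewrite ltcR.
Qed.

End RealNorm.

Lemma nrm_complete (R : realType) (V : completeNormedModType R[i])
    (u : nat -> V) :
  (forall e : R, 0 < e ->
    exists N, forall m n, (N <= m)%N -> (N <= n)%N -> nrm (u m - u n) < e) ->
  exists l, forall e : R, 0 < e ->
    exists N, forall n, (N <= n)%N -> nrm (u n - l) < e.
Proof.
move=> Cu.
have : cauchy (u @ \oo).
  apply: cauchy_exP => e e0.
  have e0' : 0 < complex.Re e by move: e0; rewrite ltcE => /andP[].
  have [N HN] := Cu _ e0'; exists (u N).
  exists N => // n /= Nn; rewrite -ball_normE /ball_ /= nrmE.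
  have -> : e = (complex.Re e)%:C by rewrite RRe_real // gtr0_real.
  by rewrite ltcR; exact: HN.
move/cauchy_cvgP => /cvg_ex[l /cvgrPdist_lt ul]; exists l => e e0.
have eC : 0 < e%:C by rewrite ltcR.
have [N _ HN] := ul _ eC; exists N => n Nn.
by have := HN n Nn; rewrite /= nrmE ltcR nrmBC.
Qed.

Lemma le_eps (R : realType) (a b c : R) :
  (forall e, 0 < e -> a <= b + c * e) -> a <= b.
Proof.
move=> H; apply/ler_addgt0Pr => e e0.
have c0 : 0 < `|c| + 1 by rewrite ltr_wpDl.
have := H (e / (`|c| + 1)); rewrite divr_gt0 // => /(_ isT) /le_trans; apply.
rewrite lerD2l mulrA ler_pdivrMr // mulrC ler_pM2l //.
by rewrite (le_trans (ler_norm c)) // lerDl.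
Qed.

Definition nlim (R : realType) (V : normedModType R[i]) (u : nat -> V) (l : V) :=
  forall e : R, 0 < e -> exists N, forall n, (N <= n)%N -> nrm (u n - l) < e.

Section NormLimits.
Context (R : realType) (V : normedModType R[i]).
Implicit Types (u v : nat -> V) (l m : V).

Lemma nlim_unique u l m : nlim u l -> nlim u m -> l = m.
Proof.
move=> ul um; apply/eqP; rewrite -subr_eq0; apply/eqP; apply: nrm_le0.
apply: (@le_eps _ _ _ 2) => e e0; rewrite add0r.
have [N HN] := ul _ e0; have [M HM] := um _ e0.
apply: (le_trans (ler_nrm_dist (u (maxn N M)) _ _)).
have := HN _ (leq_maxl N M); have := HM _ (leq_maxr N M).
by rewrite (nrmBC l (u _)); lra.
Qed.

Lemma nlim_cst l : nlim (fun=> l) l.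
Proof. by move=> e e0; exists 0%N => n _; rewrite subrr nrm0. Qed.

Lemma nlim_bound u l (c : R) : (forall n, nrm (u n) <= c) -> nlim u l -> nrm l <= c.
Proof.
move=> uc ul; apply: (@le_eps _ _ _ 1) => e e0; rewrite mul1r.
have [N HN] := ul _ e0; have := HN N (leqnn N).
by have := uc N; have := ler_nrmB (u N) (u N - l); rewrite opprB addrC subrK; lra.
Qed.

Lemma nlimD u v l m : nlim u l -> nlim v m -> nlim (fun n => u n + v n) (l + m).
Proof.
move=> ul vm e e0; have e2 : 0 < e / 2 by lra.
have [N HN] := ul _ e2; have [M HM] := vm _ e2.
exists (maxn N M) => n; rewrite geq_max => /andP[/HN h1 /HM h2].
by rewrite opprD addrACA; have := ler_nrmD (u n - l) (v n - m); lra.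
Qed.

End NormLimits.

(** * Square roots in C*-algebras *)

Section CStarBasics.
Context (R : realType) (A : cstarType R).
Implicit Types (x y z : A) (c : R[i]).

Lemma cmul0l x : 0 ∙ x = 0.
Proof. by have := cmulZl 0 (0 : A) x; rewrite !scale0r. Qed.

Lemma cmul0r x : x ∙ 0 = 0.
Proof. by have := cmulZr 0 x (0 : A); rewrite !scale0r. Qed.

Lemma cmulNl x y : (- x) ∙ y = - (x ∙ y).
Proof. by rewrite -scaleN1r cmulZl scaleN1r. Qed.

Lemma cmulNr x y : x ∙ (- y) = - (x ∙ y).
Proof. by rewrite -scaleN1r cmulZr scaleN1r. Qed.

Lemma cmulBl x y z : (x - y) ∙ z = x ∙ z - y ∙ z.
Proof. by rewrite cmulDl cmulNl. Qed.

Lemma cmulBr x y z : x ∙ (y - z) = x ∙ y - x ∙ z.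
Proof. by rewrite cmulDr cmulNr. Qed.

Lemma cmul_suml (I : Type) (r : seq I) (P : pred I) (F : I -> A) x :
  (\sum_(i <- r | P i) F i) ∙ x = \sum_(i <- r | P i) F i ∙ x.
Proof.
by elim/big_ind2: _ => // [|a b a' b' <- <-]; rewrite ?cmul0l ?cmulDl.
Qed.

Lemma cmul_sumr (I : Type) (r : seq I) (P : pred I) (F : I -> A) x :
  x ∙ (\sum_(i <- r | P i) F i) = \sum_(i <- r | P i) x ∙ F i.
Proof.
by elim/big_ind2: _ => // [|a b a' b' <- <-]; rewrite ?cmul0r ?cmulDr.
Qed.

Lemma star0 : star (0 : A) = 0.
Proof. by have := starZ 0 (0 : A); rewrite rmorph0 !scale0r. Qed.

Lemma starN x : star (- x) = - star x.
Proof. by rewrite -scaleN1r starZ rmorphN1 scaleN1r. Qed.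

Lemma starB x y : star (x - y) = star x - star y.
Proof. by rewrite starD starN. Qed.

Lemma star_sum (I : Type) (r : seq I) (P : pred I) (F : I -> A) :
  star (\sum_(i <- r | P i) F i) = \sum_(i <- r | P i) star (F i).
Proof. by elim/big_ind2: _ => // [|a b a' b' <- <-]; rewrite ?star0 ?starD. Qed.

Lemma star_inj : injective (@star R A).
Proof. exact: can_inj (@starK R A). Qed.

Lemma starZR (t : R) x : star (t%:C *: x) = t%:C *: star x.
Proof. by rewrite starZ conj_Creal ?complex_real. Qed.

Lemma star1 : star (𝟏 : A) = 𝟏.
Proof. by apply: star_inj; rewrite -{1}(cmul1l (star 𝟏)) starM !starK cmul1l. Qed.

Lemma ler_nrmM x y : nrm (x ∙ y) <= nrm x * nrm y.
Proof. by rewrite -lecR rmorphM /= -!nrmE ler_norm_cmul. Qed.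

Lemma nrm_starM x : nrm (star x ∙ x) = nrm x ^+ 2.
Proof. by apply: complexI; rewrite rmorphXn /= -!nrmE norm_starM. Qed.

Lemma nrm_star x : nrm (star x) = nrm x.
Proof.
suff H y : nrm y <= nrm (star y).
  by apply/eqP; rewrite eq_le H -{2}(starK x) H.
have [->|y0] := eqVneq (nrm y) 0; first exact: nrm_ge0.
have yp : 0 < nrm y by rewrite lt_def y0 nrm_ge0.
by rewrite -(ler_pM2r yp) -expr2 -nrm_starM ler_nrmM.
Qed.

Lemma nrm_sqr x : star x = x -> nrm (x ∙ x) = nrm x ^+ 2.
Proof. by move=> {1}<-; exact: nrm_starM. Qed.

Lemma nrm1_le1 : nrm (𝟏 : A) <= 1.
Proof.
have := nrm_starM 𝟏; rewrite star1 cmul1l => /eqP.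
rewrite expr2 -subr_eq0 -{1}(mulr1 (nrm _)) -mulrBr mulf_eq0 => /orP[] /eqP; lra.
Qed.

Lemma nlimM (u v : nat -> A) (l m : A) :
  nlim u l -> nlim v m -> nlim (fun n => u n ∙ v n) (l ∙ m).
Proof.
move=> ul vm e e0.
have c0 : 0 < nrm l + nrm m + 1 by have := nrm_ge0 l; have := nrm_ge0 m; lra.
set d := Num.min 1 (e / (nrm l + nrm m + 1)).
have d0 : 0 < d by rewrite lt_min ltr01 divr_gt0.
have [N HN] := ul _ d0; have [M HM] := vm _ d0.
exists (maxn N M) => n; rewrite geq_max => /andP[/HN h1 /HM h2].
have d1 : d <= 1 by rewrite ge_min lexx.
have de : d * (nrm l + nrm m + 1) <= e by rewrite -ler_pdivlMr // ge_min lexx orbT.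
have -> : u n ∙ v n - l ∙ m = (u n - l) ∙ (v n - m) + (u n - l) ∙ m + l ∙ (v n - m).
  by rewrite -cmulDr subrK cmulBl cmulBr addrA subrK.
set a := u n - l in h1 *; set b := v n - m in h2 *.
have := ler_nrmD (a ∙ b + a ∙ m) (l ∙ b); have := ler_nrmD (a ∙ b) (a ∙ m).
have := ler_nrmM a b; have := ler_nrmM a m; have := ler_nrmM l b.
have := nrm_ge0 l; have := nrm_ge0 m; have := nrm_ge0 a; have := nrm_ge0 b.
move: (nrm a) (nrm b) (nrm l) (nrm m) h1 h2 d0 d1 de => a' b' l' m'; nra.
Qed.

Lemma nlim_star (u : nat -> A) (l : A) : nlim u l -> nlim (star \o u) (star l).
Proof.
move=> ul e /ul[N HN]; exists N => n Nn /=.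
by rewrite -starB nrm_star; exact: HN.
Qed.

Lemma halfZ x : (2^-1 : R)%:C *: (x + x) = x.
Proof.
rewrite scalerDr -scalerDl -rmorphD /=.
by rewrite (_ : _ + _ = 1) ?scale1r //; lra.
Qed.

(* Unitary trick: [u = b + i w] satisfies [u^* u = m] and [b = (u + u^* )/2]. *)
Lemma nrm_sum_squares b w (m : R) : star b = b -> star w = w ->
  b ∙ w = w ∙ b -> 0 <= m -> b ∙ b + w ∙ w = m%:C *: (𝟏 : A) -> nrm b ^+ 2 <= m.
Proof.
move=> bs ws bw m0 H.
pose u := b + 'i *: w.
have us : star u = b - 'i *: w.
  by rewrite /u starD starZ bs ws /= -scaleNr; congr (_ + _ *: _); exact: conjCi.
have uu : star u ∙ u = m%:C *: (𝟏 : A).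
  rewrite us /u cmulBl !cmulDr !cmulZl !cmulZr scalerA bw -H.
  by rewrite opprD addrA addrK -expr2 sqr_i scaleN1r opprK.
have nu : nrm u ^+ 2 <= m.
  rewrite -nrm_starM uu nrmZR ger0_norm //.
  by rewrite ler_piMr ?nrm1_le1.
have -> : b = (2^-1 : R)%:C *: (u + star u).
  by rewrite us /u addrACA subrr addr0 halfZ.
apply: le_trans nu; rewrite ler_sqr ?nnegrE ?nrm_ge0 // nrmZR.
by have := ler_nrmD u (star u); rewrite nrm_star ger0_norm; lra.
Qed.

End CStarBasics.

(* The iteration [y := (z + y^2) / 2] from [0] converges to [1 - sqrt (1 - z)],
   and is dominated by its scalar version at [z = 1]. *)
Fixpoint sqrt_scalar (R : realType) (n : nat) : R :=
  if n is n'.+1 then (1 + sqrt_scalar R n' ^+ 2) / 2 else 0.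

Lemma sqrt_scalar_ge0 (R : realType) n : 0 <= sqrt_scalar R n.
Proof. by elim: n => //= n IH; have := sqr_ge0 (sqrt_scalar R n); lra. Qed.

(** With [d = 1 - sqrt_scalar R n], the next distance is [d - d^2 / 2]: the limit is a double root
    of the fixed-point equation, hence a decay of order [1/n] only. *)
Lemma sqrt_scalar_near1 (R : realType) n :
  0 <= 1 - sqrt_scalar R n <= 2 / n.+2%:R.
Proof.
elim: n => [|n /andP[h0 h1]] /=; first by apply/andP; split; lra.
have t0 := sqrt_scalar_ge0 R n.
set t := sqrt_scalar R n in h0 h1 t0 *; apply/andP; split; first by nra.
have n0 : 0 < n.+2%:R :> R by rewrite ltr0n.
rewrite -(natr1 n.+2); set k := n.+2%:R in n0 h1 *.
rewrite ler_pdivlMr; last lra.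
have k1 : (1 - t) * k <= 2 by rewrite -ler_pdivlMr.
have k2 : 2 <= k by rewrite ler_nat.
nra.
Qed.

Section SquareRoot.
Context (R : realType) (A : cstarType R).
Implicit Types (x y z c : A).

Fixpoint sqrt_seq z (n : nat) : A :=
  if n is n'.+1 then (2^-1 : R)%:C *: (z + sqrt_seq z n' ∙ sqrt_seq z n') else 0.

Lemma sqrt_seq_comm x z : x ∙ z = z ∙ x ->
  forall n, x ∙ sqrt_seq z n = sqrt_seq z n ∙ x.
Proof.
move=> xz; elim=> [|n IH] /=; first by rewrite cmul0l cmul0r.
by rewrite cmulZl cmulZr cmulDl cmulDr xz cmulA IH -!cmulA IH.
Qed.

Lemma sqrt_seq_commute z m n : sqrt_seq z m ∙ sqrt_seq z n = sqrt_seq z n ∙ sqrt_seq z m.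
Proof. by apply: sqrt_seq_comm; apply/esym/sqrt_seq_comm. Qed.

Lemma sqrt_seq_star z : star z = z -> forall n, star (sqrt_seq z n) = sqrt_seq z n.
Proof.
move=> zs; elim=> [|n IH] /=; first exact: star0.
by rewrite starZR starD starM zs IH.
Qed.

Lemma nrm_sqrt_seq z : nrm z <= 1 -> forall n, nrm (sqrt_seq z n) <= sqrt_scalar R n.
Proof.
move=> z1; elim=> [|n IH] /=; first by rewrite nrm0.
rewrite nrmZR ger0_norm; last lra.
have := ler_nrmD z (sqrt_seq z n ∙ sqrt_seq z n).
have := ler_nrmM (sqrt_seq z n) (sqrt_seq z n).
have := nrm_ge0 (sqrt_seq z n); have := sqrt_scalar_ge0 R n.
move: (nrm (sqrt_seq z n)) (sqrt_scalar R n) IH => a b; nra.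
Qed.

(** The iterates commute, so a difference of squares factors as [(p - q) ∙ (p + q)], just as for the
    scalar increments. Telescoping then makes the sequence Cauchy. *)
Lemma nrm_sqrt_seqS z n : nrm z <= 1 ->
  nrm (sqrt_seq z n.+1 - sqrt_seq z n) <= sqrt_scalar R n.+1 - sqrt_scalar R n.
Proof.
move=> z1; elim: n => [|n IH].
  rewrite /= subr0 cmul0l addr0 nrmZR ger0_norm; last lra.
  by rewrite expr0n /= addr0 subr0; lra.
set p := sqrt_seq z n.+1 in IH *; set q := sqrt_seq z n in IH *.
set a := sqrt_scalar R n.+1 in IH *; set b := sqrt_scalar R n in IH *.
have -> : sqrt_seq z n.+2 - p = (2^-1 : R)%:C *: ((p - q) ∙ (p + q)).
  rewrite [X in _ - X]/(sqrt_seq z n.+1) [sqrt_seq z n.+2]/= -/p -/q -scalerBr.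
  congr (_ *: _); rewrite opprD addrACA subrr add0r.
  have pq : p ∙ q = q ∙ p by exact: sqrt_seq_commute.
  by rewrite cmulBl !cmulDr pq opprD addrA addrK.
have -> : sqrt_scalar R n.+2 - a = (a - b) * (a + b) / 2.
  by rewrite /a /b /=; field.
rewrite nrmZR ger0_norm; last lra.
have := ler_nrmM (p - q) (p + q); have := ler_nrmD p q.
have := nrm_sqrt_seq z1 n.+1; have := nrm_sqrt_seq z1 n; rewrite -/p -/q -/a -/b.
have := nrm_ge0 (p - q); have := nrm_ge0 (p + q).
move: (nrm (p - q)) (nrm (p + q)) (nrm p) (nrm q) IH => r s u v; nra.
Qed.

Lemma nrm_sqrt_seqD z n k : nrm z <= 1 ->
  nrm (sqrt_seq z (n + k) - sqrt_seq z n) <= sqrt_scalar R (n + k) - sqrt_scalar R n.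
Proof.
move=> z1; elim: k => [|k IH]; first by rewrite addn0 !subrr nrm0.
rewrite addnS; have := ler_nrm_dist (sqrt_seq z (n + k)) (sqrt_seq z (n + k).+1)
  (sqrt_seq z n).
have := nrm_sqrt_seqS (n + k) z1; lra.
Qed.

(** The root is [𝟏 - l] for the limit [l] of the iteration, by [l + l = z + l ∙ l]. The bound on
    [𝟏 - s] allows a root of [s] itself to be taken, and the commutation clause lets later arguments
    multiply roots. *)
Lemma cstar_sqrt z : star z = z -> nrm z <= 1 ->
  exists s, [/\ star s = s, s ∙ s = 𝟏 - z, nrm (𝟏 - s) <= 1 &
    forall x, x ∙ z = z ∙ x -> x ∙ s = s ∙ x].
Proof.
move=> zs z1.
have [l ul] : exists l, nlim (sqrt_seq z) l.
  apply: nrm_complete => e e0.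
  have [N HN] : exists N : nat, 2 / N.+2%:R < e.
    exists (Num.Def.archi_bound (2 / e)).
    rewrite ltr_pdivrMr ?ltr0n // mulrC -ltr_pdivrMr //.
    apply: lt_le_trans (archi_boundP _) _; first by rewrite divr_ge0 // ltW.
    by rewrite ler_nat; apply: leq_trans (leqnSn _) (leqnSn _).
  exists N; suff H m n : (N <= m)%N -> (m <= n)%N -> nrm (sqrt_seq z n - sqrt_seq z
    m) < e.
    move=> m n Nm Nn; case/orP: (leq_total m n) => mn; last exact: H.
    by rewrite nrmBC; exact: H.
  move=> Nm mn; rewrite -(subnKC mn).
  apply: le_lt_trans (nrm_sqrt_seqD _ _ z1) _; rewrite subnKC //.
  have /andP[_ hm] := sqrt_scalar_near1 R m; have /andP[hn _] := sqrt_scalar_near1 R n.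
  apply: le_lt_trans HN.
  apply: (@le_trans _ _ (2 / m.+2%:R)).
    by apply: le_trans hm; rewrite lerB // -subr_ge0.
  by rewrite ler_pM2l // lef_pV2 ?posrE ?ltr0n // ler_nat.
have lE : l + l = z + l ∙ l.
  have h1 : nlim (fun n => sqrt_seq z n.+1 + sqrt_seq z n.+1) (l + l).
    by apply: nlimD => e /ul[N HN]; exists N => n Nn; apply: HN; rewrite leqW.
  have h2 : nlim (fun n => z + sqrt_seq z n ∙ sqrt_seq z n) (z + l ∙ l).
    by apply: nlimD; [exact: nlim_cst|exact: nlimM].
  apply: nlim_unique h1 _ => e /h2[N HN]; exists N => n /HN.
  by rewrite /= -scalerDr halfZ.
exists (𝟏 - l); split.
- rewrite starB star1; congr (_ - _).
  apply: nlim_unique (nlim_star ul) _ => e /ul[N HN]; exists N => n /HN.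
  by rewrite /= sqrt_seq_star.
- rewrite cmulBl !cmulBr !cmul1l cmul1r.
  have -> : z = l + l - l ∙ l by rewrite lE addrK.
  by rewrite -addrA -opprD addrA.
- rewrite opprB addrC subrK; apply: nlim_bound ul => n.
  apply: le_trans (nrm_sqrt_seq z1 n) _.
  by have /andP[+ _] := sqrt_scalar_near1 R n; lra.
- move=> x xz; rewrite cmulBl cmulBr cmul1l cmul1r; congr (_ - _).
  apply: nlim_unique (nlimM (nlim_cst x) ul) _ => e.
  move=> /(nlimM ul (nlim_cst x))[N HN]; exists N => n /HN.
  by rewrite /= sqrt_seq_comm.
Qed.

(** A root [w] of [𝟏 - c ∙ c] commutes with [c] and satisfies [w ∙ w + c ∙ c = 𝟏], so the unitary
    trick bounds it by [1]. *)
Lemma nrm_sub1_sqr c : star c = c -> nrm c <= 1 -> nrm (𝟏 - c ∙ c) <= 1.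
Proof.
move=> cs c1; have ccs : star (c ∙ c) = c ∙ c by rewrite starM cs.
have [|w [ws ww _ wc]] := cstar_sqrt ccs.
  by have := ler_nrmM c c; have := nrm_ge0 c; nra.
have cw : c ∙ w = w ∙ c by apply: wc; rewrite cmulA.
rewrite -ww nrm_sqr //; apply: (nrm_sum_squares (w := c)) => //.
by rewrite ww subrK scale1r.
Qed.

(* [s ∙ s] is the absolute value of [c]. *)
Lemma cstar_abs c : star c = c ->
  exists s, [/\ star s = s, (s ∙ s) ∙ (s ∙ s) = c ∙ c & forall x, x ∙ c = c ∙ x -> x
    ∙ s = s ∙ x].
Proof.
move=> cs; have [->|/eqP c0] := eqVneq c 0.
  by exists 0; split; rewrite ?star0 ?cmul0l // => x _; rewrite cmul0l cmul0r.
have M0 := nrm_gt0 c0; set M := nrm c in M0.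
pose c' := (M^-1)%:C *: c.
have c's : star c' = c' by rewrite starZR cs.
have c'1 : nrm c' <= 1 by rewrite nrmZR gtr0_norm ?invr_gt0 // mulVf ?gt_eqF.
have zs : star (𝟏 - c' ∙ c') = 𝟏 - c' ∙ c' by rewrite starB star1 starM c's.
(* [d] is the absolute value of the normalized [c'], and the [s] that follows is a root of [d],
   available because [𝟏 - d] has norm at most [1]. *)
have [d [ds dd d1 dc]] := cstar_sqrt zs (nrm_sub1_sqr c's c'1).
have [|s [ss sE _ sc]] := cstar_sqrt _ d1; first by rewrite starB star1 ds.
exists ((Num.sqrt M)%:C *: s); split.
- by rewrite starZR ss.
- have sd : s ∙ s = d by rewrite sE opprB addrC subrK.
  have dc' : d ∙ d = c' ∙ c' by rewrite dd opprB addrC subrK.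
  have cE : c = M%:C *: c'.
    by rewrite scalerA -rmorphM /= mulfV ?gt_eqF // scale1r.
  rewrite !(cmulZl _ s) !(cmulZr _ s) sd !scalerA -rmorphM /= -expr2 sqr_sqrtr ?ltW //.
  move: (c') cE dc' => b -> dc'.
  by rewrite !cmulZl !cmulZr dc'.
- move=> x xc; rewrite cmulZl cmulZr sc // cmulBl cmulBr cmul1l cmul1r dc //.
  by rewrite cmulBl cmulBr cmul1l cmul1r /c' !(cmulZl, cmulZr) cmulA xc -!cmulA xc.
Qed.

End SquareRoot.

Section SqrtScaled.
Context (R : realType) (A : cstarType R).
Implicit Types (b : A).

Lemma cstar_sqrt_sub b (M : R) : star b = b -> nrm b <= M ->
  exists w : A, [/\ star w = w, w ∙ w = M%:C *: 𝟏 - b &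
    forall x, x ∙ b = b ∙ x -> x ∙ w = w ∙ x].
Proof.
move=> bs bM; have [M0|M0] := leP M 0.
  have -> : b = 0 by apply: nrm_le0; apply: le_trans M0.
  have -> : M = 0 by apply/eqP; rewrite eq_le M0 (le_trans _ bM) ?nrm_ge0.
  by exists 0; split; rewrite ?star0 ?cmul0l ?scale0r ?subr0 // => x _;
    rewrite cmul0l cmul0r.
have [|| s [ss sE _ sc]] := @cstar_sqrt _ _ ((M^-1)%:C *: b).
- by rewrite starZR bs.
- by rewrite nrmZR gtr0_norm ?invr_gt0 // mulrC ler_pdivrMr // mul1r.
exists ((Num.sqrt M)%:C *: s); split.
- by rewrite starZR ss.
- rewrite cmulZl cmulZr scalerA -rmorphM -expr2 sqr_sqrtr ?ltW // sE scalerBr.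
  by rewrite scalerA -rmorphM mulfV ?gt_eqF // rmorph1 scale1r.
- by move=> x xb; rewrite cmulZl cmulZr sc // cmulZl cmulZr xb.
Qed.

End SqrtScaled.

Section StarMorphisms.
Context (R : realType) (A B : cstarType R).
Implicit Types f : {starmorphism A -> B}.

(** For self-adjoint [b], the relation [b ∙ b + w ∙ w = (nrm b)^2 𝟏] with commuting [w] survives the
    morphism, and the unitary trick applies in [B]. The C*-identity gives the general case. *)
Lemma nrm_starmorph f a : nrm (f a) <= nrm a.
Proof.
have sa b : star b = b -> nrm (f b) <= nrm b.
  move=> bs; have bbs : star (b ∙ b) = b ∙ b by rewrite starM bs.
  have [|w [ws ww wc]] := @cstar_sqrt_sub _ _ _ (nrm b ^+ 2) bbs.
    by rewrite nrm_sqr.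
  rewrite -(@ler_pXn2r _ 2) ?nnegrE ?nrm_ge0 //.
  apply: (@nrm_sum_squares _ _ _ (f w)); rewrite -?star_morph_star ?bs ?ws ?sqr_ge0 //.
    by rewrite -!star_morphM wc // cmulA.
  by rewrite -!star_morphM ww -linearD addrC subrK linearZ /= star_morph1.
rewrite -(@ler_pXn2r _ 2) ?nnegrE ?nrm_ge0 // -!nrm_starM -star_morph_star -star_morphM.
by apply: sa; rewrite starM starK.
Qed.

End StarMorphisms.

(** * Faithful representations are isometric *)

Section Hilbert.
Context (R : realType) (E : hilbertSpace R).
Implicit Types (x y : E).

Lemma hdotE x : hdot E x x = (nrm x ^+ 2)%:C.
Proof. by rewrite hdot_norm nrmE rmorphXn. Qed.

Lemma hdotC x y : hdot E y x = Num.conj (hdot E x y).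
Proof. by rewrite (hermitian_subproof y x) expr0 mul1r. Qed.

Lemma hdot_eq0 x : (forall y, hdot E x y = 0) -> x = 0.
Proof.
move=> /(_ x); rewrite hdotE => /complexI/eqP; rewrite sqrf_eq0 => /eqP.
exact: nrm0_eq0.
Qed.

Lemma hdot_CauchySchwarz x y : nrm (hdot E x y : R[i]^o) <= nrm x * nrm y.
Proof.
have [->|/eqP y0] := eqVneq y 0; first by rewrite linear0r nrm0 mulr_ge0 ?nrm_ge0.
have Y0 := nrm_gt0 y0.
suff : nrm (hdot E x y : R[i]^o) ^+ 2 <= nrm x ^+ 2 * nrm y ^+ 2.
  by rewrite -exprMn ler_pXn2r // nnegrE ?mulr_ge0 ?nrm_ge0.
rewrite -lecR.
have -> : (nrm (hdot E x y : R[i]^o) ^+ 2)%:C = hdot E x y * Num.conj (hdot E x y).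
  by rewrite rmorphXn /= -nrmE normCK.
have H := hdotE ((nrm y ^+ 2)%:C *: x - hdot E x y *: y).
rewrite linearBl !linearBr /= !linearZl_LR !linearZr_LR /= in H.
rewrite !hdotE (hdotC x y) conj_Creal ?complex_real // in H.
move: H.
set p := hdot E x y; set X := nrm x ^+ 2; set Y := nrm y ^+ 2 => H.
have Yp : 0 < Y by rewrite exprn_gt0.
rewrite -(ler_pM2l (_ : 0 < Y%:C)) ?ltcR // -subr_ge0.
move: H; set q := Num.conj p; set n := nrm _ => H.
rewrite [leRHS](_ : _ = (n ^+ 2)%:C).
  by rewrite ler0c sqr_ge0.
have XY : (X * Y)%:C = X%:C * Y%:C by rewrite -rmorphM.
by rewrite XY -H /GRing.scale /=; ring.
Qed.

End Hilbert.

Section ComplexParts.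
Context (R : realType).
Implicit Types c d : R[i].

Lemma ReD c d : complex.Re (c + d) = complex.Re c + complex.Re d.
Proof. by case: c; case: d. Qed.

Lemma ReN c : complex.Re (- c) = - complex.Re c.
Proof. by case: c. Qed.

Lemma ReZ (t : R) c : complex.Re (t%:C * c) = t * complex.Re c.
Proof. by case: c => a b /=; rewrite mul0r subr0. Qed.

Lemma norm_Re_le c : `|complex.Re c| <= nrm (c : R[i]^o).
Proof. by rewrite -lecR -nrmE normc_ge_Re. Qed.

Lemma Re_le_nrm c : complex.Re c <= nrm (c : R[i]^o).
Proof. exact: le_trans (ler_norm _) (norm_Re_le _). Qed.

End ComplexParts.

Section Representation.
Context (R : realType) (A : cstarType R) (E : hilbertSpace R).
Context (act : {bilinear A -> E -> E}) (actP : faithful_representation act).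
Implicit Types (a b c z : A) (x y : E).

Definition qform a x : R := complex.Re (hdot E (act a x) x).

Lemma qformD a b x : qform (a + b) x = qform a x + qform b x.
Proof. by rewrite /qform linearDl linearDl ReD. Qed.

Lemma qformN a x : qform (- a) x = - qform a x.
Proof. by rewrite /qform linearNl linearNl ReN. Qed.

Lemma qformB a b x : qform (a - b) x = qform a x - qform b x.
Proof. by rewrite qformD qformN. Qed.

Lemma qformZ (t : R) a x : qform (t%:C *: a) x = t * qform a x.
Proof. by rewrite /qform linearZl_LR /= linearZl_LR ReZ. Qed.

Lemma qform1 x : qform 𝟏 x = nrm x ^+ 2.
Proof. by case: actP => _ _ act1 _ _; rewrite /qform act1 hdotE. Qed.

Lemma qform_starM a x : qform (star a ∙ a) x = nrm (act a x) ^+ 2.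
Proof.
case: actP => _ actM _ act_star _.
by rewrite /qform actM act_star starK hdotE.
Qed.

Lemma qform_sqr a x : star a = a -> qform (a ∙ a) x = nrm (act a x) ^+ 2.
Proof. by move=> as_; rewrite -{1}as_ qform_starM. Qed.

(** [(nrm a)^2 𝟏 - star a ∙ a] is a square [w ∙ w], so its quadratic form is
    [nrm (act w x) ^+ 2]. *)
Lemma nrm_rep a x : nrm (act a x) <= nrm a * nrm x.
Proof.
have bs : star (star a ∙ a) = star a ∙ a by rewrite starM starK.
have [|w [ws ww _]] := @cstar_sqrt_sub _ _ _ (nrm a ^+ 2) bs.
  by rewrite nrm_starM.
have := qform_sqr x ws; rewrite ww qformB qformZ qform1 qform_starM => H.
rewrite -(@ler_pXn2r _ 2) ?nnegrE ?mulr_ge0 ?nrm_ge0 // exprMn -subr_ge0 H.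
exact: sqr_ge0.
Qed.

Lemma qform_le_nrm a x : `|qform a x| <= nrm a * nrm x ^+ 2.
Proof.
apply: le_trans (norm_Re_le _) _; apply: le_trans (hdot_CauchySchwarz _ _) _.
by rewrite expr2 mulrA ler_wpM2r ?nrm_ge0 // nrm_rep.
Qed.

Lemma rep_inj a : (forall x, act a x = 0) -> a = 0.
Proof. by case: actP => _ _ _ _; apply. Qed.

(* With [|c| = s^2], the operators of [c] and [|c|] have the same square, commute
   and have an injective sum, so they agree. *)
Lemma rep_sqrt c (k : R) : star c = c -> 0 < k ->
  (forall x, k * nrm x ^+ 2 <= qform c x) ->
  exists s : A, [/\ star s = s, s ∙ s = c & forall a, a ∙ c = c ∙ a -> a ∙ s = s ∙ a].
Proof.
move=> cs k0 ck; have [s [ss sE sc]] := cstar_abs cs; exists s; split => //.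
apply/eqP; rewrite -subr_eq0; apply/eqP/rep_inj => x.
set d := s ∙ s in sE *; set v := act (d - c) x.
have dc : c ∙ d = d ∙ c by rewrite /d cmulA sc // -!cmulA sc.
have vE : act (d + c) v = 0.
  case: actP => _ actM _ _ _; rewrite /v -actM.
  by rewrite cmulDl !cmulBr sE dc addrA subrK subrr linear0l.
have : qform (d + c) v = 0 by rewrite /qform vE linear0l.
rewrite qformD qform_sqr // => H.
have := ck v; have := sqr_ge0 (nrm (act s v)) => h1 h2.
have v0 : k * nrm v ^+ 2 <= 0 by lra.
apply: nrm0_eq0; apply/eqP; rewrite -sqrf_eq0 eq_le sqr_ge0 andbT.
by rewrite -(ler_pM2l k0) mulr0.
Qed.

(* [(M + e) - b = r^2] and [(M + e) + b = s^2] yield [b^2 + (s r)^2 = (M + e)^2]. *)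
Lemma nrm_le_qform b (M : R) : star b = b -> 0 <= M ->
  (forall x, `|qform b x| <= M * nrm x ^+ 2) -> nrm b <= M.
Proof.
move=> bs M0 bM; apply: (@le_eps _ _ _ 1) => e e0; rewrite mul1r.
have [|//||r [rs rr rc]] := @rep_sqrt ((M + e)%:C *: 𝟏 - b) e.
- by rewrite starB starZR star1 bs.
- move=> x; rewrite qformB qformZ qform1; have := bM x.
  by rewrite ler_norml => /andP[]; lra.
have [|//||s [ss sE sc]] := @rep_sqrt ((M + e)%:C *: 𝟏 + b) e.
- by rewrite starD starZR star1 bs.
- move=> x; rewrite qformD qformZ qform1; have := bM x.
  by rewrite ler_norml => /andP[]; lra.
have br : b ∙ r = r ∙ b.
  by apply: rc; rewrite cmulBl cmulBr cmulZl cmulZr cmul1l cmul1r.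
have bs' : b ∙ s = s ∙ b.
  by apply: sc; rewrite cmulDl cmulDr cmulZl cmulZr cmul1l cmul1r.
have sr : s ∙ r = r ∙ s.
  apply: rc; rewrite cmulBl cmulBr cmulZl cmulZr cmul1l cmul1r bs' //.
have Me0 : 0 <= M + e by lra.
rewrite -(@ler_pXn2r _ 2) ?nnegrE ?nrm_ge0 //.
apply: (@nrm_sum_squares _ _ _ (s ∙ r)) => //; rewrite ?sqr_ge0 //.
- by rewrite starM ss rs.
- by rewrite cmulA bs' -!cmulA br.
- rewrite -cmulA (cmulA r) -sr -(cmulA s) rr cmulA sE.
  rewrite cmulDl !cmulBr !(cmulZl, cmulZr) !cmul1l cmul1r scalerA -rmorphM -expr2.
  set Kb := (M + e)%:C *: b; set bb := b ∙ b.
  by rewrite [X in _ + X]addrA [X in _ + (X - _)]subrK addrC subrK.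
Qed.

Lemma isometry_rep a (M : R) : 0 <= M ->
  (forall x, nrm (act a x) <= M * nrm x) -> nrm a <= M.
Proof.
move=> M0 aM; rewrite -(@ler_pXn2r _ 2) ?nnegrE ?nrm_ge0 // -nrm_starM.
apply: nrm_le_qform; rewrite ?sqr_ge0 ?starM ?starK // => x.
rewrite qform_starM ger0_norm ?sqr_ge0 // -exprMn.
by rewrite ler_pXn2r // nnegrE ?mulr_ge0 ?nrm_ge0.
Qed.

Lemma isometry_form a (M : R) : 0 <= M ->
  (forall x y, nrm (hdot E (act a x) y : R[i]^o) <= M * nrm x * nrm y) -> nrm a <= M.
Proof.
move=> M0 aM; apply: isometry_rep => // x.
have [->|/eqP/nrm_gt0 H] := eqVneq (act a x) 0; first by rewrite nrm0 mulr_ge0 ?nrm_ge0.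
rewrite -(ler_pM2r H); apply: le_trans (aM x (act a x)).
by rewrite -expr2 -[_ ^+ 2]/(complex.Re (nrm (act a x) ^+ 2)%:C) -hdotE Re_le_nrm.
Qed.

(** The form of [(nrm z) 𝟏 - z] lies between [0] and [nrm z], so this element has norm at most
    [nrm z] and [z] has a root. Positivity seen in one representation thus becomes algebraic, and
    can be carried to another one. *)
Lemma pos_square z : star z = z -> (forall x, 0 <= qform z x) ->
  exists s, z = star s ∙ s.
Proof.
move=> zs z0.
have [||w [ws ww _]] := @cstar_sqrt_sub _ A ((nrm z)%:C *: 𝟏 - z) (nrm z).
- by rewrite starB starZR star1 zs.
- apply: nrm_le_qform; rewrite ?nrm_ge0 //.
    by rewrite starB starZR star1 zs.
  move=> x; rewrite qformB qformZ qform1; have := qform_le_nrm z x.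
  by have := z0 x; rewrite !ler_norml => h /andP[h1 h2]; apply/andP; split; lra.
by exists w; rewrite ws ww opprB addrC subrK.
Qed.

End Representation.

(** * Bounded maps and slices *)

(** A predicate on bare functions with an explicit constant: composites of slices, functionals and
    morphisms get their bounds without being packaged as structures. Functionals take values in
    [R[i]^o], the scalars seen as a normed module. *)
Definition bounded_by (R : realType) (V W : normedModType R[i]) (C : R) (f : V -> W) :=
  [/\ forall (c : R[i]) x y, f (c *: x + y) = c *: f x + f y,
      0 <= C & forall x, nrm (f x) <= C * nrm x].

Section Bounded.
Context (R : realType) (V W : normedModType R[i]) (C : R) (f : V -> W).
Hypothesis fC : bounded_by C f.

Lemma bdd0 : f 0 = 0.
Proof.
case: fC => fl _ _; have := fl (-1) 0 0.
by rewrite scaler0 addr0 scaleN1r addNr.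
Qed.

Lemma bddD x y : f (x + y) = f x + f y.
Proof. by case: fC => fl _ _; have := fl 1 x y; rewrite !scale1r. Qed.

Lemma bddZ c x : f (c *: x) = c *: f x.
Proof. by case: fC => fl _ _; have := fl c x 0; rewrite bdd0 !addr0. Qed.

Lemma bddN x : f (- x) = - f x.
Proof. by rewrite -scaleN1r bddZ scaleN1r. Qed.

Lemma bddB x y : f (x - y) = f x - f y.
Proof. by rewrite bddD bddN. Qed.

Lemma bdd_sum (I : Type) (r : seq I) (P : pred I) (F : I -> V) :
  f (\sum_(i <- r | P i) F i) = \sum_(i <- r | P i) f (F i).
Proof. by elim/big_ind2: _ => [|x a y b <- <-|//]; rewrite ?bdd0 ?bddD. Qed.

Lemma bdd_ge0 : 0 <= C. Proof. by case: fC. Qed.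

Lemma bdd_nrm x : nrm (f x) <= C * nrm x.
Proof. by case: fC => _ _; apply. Qed.

End Bounded.

Section BoundedTheory.
Context (R : realType).
Implicit Types V W U : normedModType R[i].

Lemma bdd_comp V W U (C D : R) (f : V -> W) (g : W -> U) :
  bounded_by C f -> bounded_by D g -> bounded_by (D * C) (g \o f).
Proof.
move=> fC gD; split=> [c x y||x] /=.
- by rewrite (bddD fC) (bddZ fC) (bddD gD) (bddZ gD).
- by rewrite mulr_ge0 ?(bdd_ge0 fC) ?(bdd_ge0 gD).
- apply: le_trans (bdd_nrm gD _) _; rewrite -mulrA ler_wpM2l ?(bdd_ge0 gD) //.
  exact: bdd_nrm.
Qed.

Lemma bdd_id V : bounded_by 1 (@id V).
Proof. by split=> // x; rewrite mul1r. Qed.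

Lemma bdd_weaken V W (C D : R) (f : V -> W) : C <= D -> bounded_by C f -> bounded_by D f.
Proof.
move=> CD fC; split=> [c x y||x]; first by rewrite (bddD fC) (bddZ fC).
  exact: le_trans (bdd_ge0 fC) CD.
by apply: le_trans (bdd_nrm fC x) _; rewrite ler_wpM2r ?nrm_ge0.
Qed.

Lemma bdd_add V W (C D : R) (f g : V -> W) :
  bounded_by C f -> bounded_by D g -> bounded_by (C + D) (fun x => f x + g x).
Proof.
move=> fC gD; split=> [c x y||x].
- by rewrite (bddD fC) (bddZ fC) (bddD gD) (bddZ gD) scalerDr addrACA.
- by rewrite addr_ge0 ?(bdd_ge0 fC) ?(bdd_ge0 gD).
- apply: le_trans (ler_nrmD _ _) _; rewrite mulrDl lerD //;
    [exact: bdd_nrm fC _|exact: bdd_nrm gD _].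
Qed.

Lemma bdd_scale V W (C : R) (k : R[i]) (f : V -> W) :
  bounded_by C f -> bounded_by (nrm (k : R[i]^o) * C) (fun x => k *: f x).
Proof.
move=> fC; split=> [c x y||x].
- by rewrite (bddD fC) (bddZ fC) scalerDr !scalerA mulrC.
- by rewrite mulr_ge0 ?nrm_ge0 ?(bdd_ge0 fC).
- rewrite nrmZ -mulrA ler_wpM2l //; [exact: nrm_ge0 (k : R[i]^o)|exact: bdd_nrm fC _].
Qed.

Lemma bdd_dense V W (C D : R) (S : set V) (f g : V -> W) :
  dense (lin_span S) -> bounded_by C f -> bounded_by D g ->
  (forall x, S x -> f x = g x) -> forall x, f x = g x.
Proof.
move=> dS fC gD fg x; apply/eqP; rewrite -subr_eq0; apply/eqP/nrm_le0.
apply: (@le_eps _ _ _ (C + D)) => e e0; rewrite add0r.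
have [y [n [c [s [Ss yE]]]] xy] := dense_nrm dS x e0.
have fgy : f y = g y.
  rewrite yE (bdd_sum fC) (bdd_sum gD); apply: eq_bigr => i _.
  by rewrite (bddZ fC) (bddZ gD) fg.
rewrite -(subrK y x) (bddD fC) (bddD gD) fgy opprD addrACA subrr addr0.
apply: le_trans (ler_nrmB _ _) _.
have := bdd_nrm fC (x - y); have := bdd_nrm gD (x - y).
have := bdd_ge0 fC; have := bdd_ge0 gD; have := nrm_ge0 (x - y); nra.
Qed.

End BoundedTheory.

Section Extension.
Context (R : realType) (V : normedModType R[i]) (W : completeNormedModType R[i]).
Context (I : Type) (p : I -> V) (q : I -> W) (C : R).
Hypothesis C0 : 0 <= C.
Hypothesis p_dense : dense (lin_span [set x | exists i, x = p i]).
Hypothesis pq : forall l : seq (R[i] * I),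
  nrm (\sum_(t <- l) t.1 *: q t.2) <= C * nrm (\sum_(t <- l) t.1 *: p t.2).

Let G v w := exists l : seq (R[i] * I),
  v = \sum_(t <- l) t.1 *: p t.2 /\ w = \sum_(t <- l) t.1 *: q t.2.

Let G_lin c v w v' w' : G v w -> G v' w' -> G (c *: v + v') (c *: w + w').
Proof.
move=> [l [-> ->]] [l' [-> ->]].
exists ([seq (c * t.1, t.2) | t <- l] ++ l').
rewrite !big_cat /= !big_map /= !scaler_sumr.
by split; congr (_ + _); apply: eq_bigr => t _; rewrite scalerA.
Qed.

Let G_nrm v w : G v w -> nrm w <= C * nrm v.
Proof. by move=> [l [-> ->]]. Qed.

Let G_dense x e : 0 < e -> exists2 vw, G vw.1 vw.2 & nrm (x - vw.1) < e.
Proof.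
move=> e0; have [y [n [c [s [Ss yE]]]] xy] := dense_nrm p_dense x e0.
have [i si] := choice Ss.
exists (y, \sum_(k < n) c k *: q (i k)) => //=.
exists [seq (c k, i k) | k <- index_enum 'I_n]; rewrite !big_map; split => //.
by rewrite yE; apply: eq_bigr => k _; rewrite si.
Qed.

Let Gbar x w := forall e : R, 0 < e ->
  exists v w', [/\ G v w', nrm (x - v) < e & nrm (w - w') < e].

Let Gbar_nrm x w : Gbar x w -> nrm w <= C * nrm x.
Proof.
move=> xw; apply: (@le_eps _ _ _ (1 + C)) => e e0.
have [v [w' [/G_nrm vw xv ww']]] := xw _ e0.
have := ler_nrmD (w - w') w'; rewrite subrK.
have := ler_nrmB x (x - v); rewrite opprB addrC subrK.
move=> vx wle; have /(ler_wpM2l C0) : nrm v <= nrm x + e by lra.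
by rewrite mulrDr; lra.
Qed.

Let Gbar_lin c x w y z : Gbar x w -> Gbar y z -> Gbar (c *: x + y) (c *: w + z).
Proof.
move=> xw yz e e0; set k := nrm (c : R[i]^o).
have k0 : 0 <= k by exact: nrm_ge0.
have k1 : 0 < k + 1 by lra.
have d0 : 0 < e / (k + 1) by rewrite divr_gt0.
have [v [w' [vw' xv ww']]] := xw _ d0; have [u [z' [uz' yu zz']]] := yz _ d0.
exists (c *: v + u), (c *: w' + z'); split; first exact: G_lin.
- rewrite opprD addrACA -scalerBr; apply: le_lt_trans (ler_nrmD _ _) _.
  rewrite nrmZ -/k -[ltRHS](divfK (lt0r_neq0 k1)); move: d0 xv yu; set d := e / _;
    set a := nrm _; set b := nrm _; nra.
- rewrite opprD addrACA -scalerBr; apply: le_lt_trans (ler_nrmD _ _) _.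
  rewrite nrmZ -/k -[ltRHS](divfK (lt0r_neq0 k1)); move: d0 ww' zz'; set d := e / _;
    set a := nrm _; set b := nrm _; nra.
Qed.

Let Gbar_ex x : exists w, Gbar x w.
Proof.
have /choice[vw Hvw] : forall n : nat, exists vw, G vw.1 vw.2 /\ nrm (x - vw.1) <
  n.+1%:R^-1.
  by move=> n; have [|vw] := @G_dense x n.+1%:R^-1; [rewrite invr_gt0 ltr0n|exists vw].
have small e : 0 < e -> exists N, forall n, (N <= n)%N -> n.+1%:R^-1 < e :> R.
  move=> e0; exists (Num.Def.archi_bound e^-1) => n Nn.
  rewrite invf_plt ?posrE ?ltr0n //; apply: lt_le_trans (archi_boundP _) _.
    by rewrite invr_ge0 ltW.
  by rewrite ler_nat; apply: leq_trans Nn (leqnSn _).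
have [w Hw] : exists w, nlim (fun n => (vw n).2) w.
  apply: nrm_complete => e e0.
  have c1 : 0 < 2 * C + 1 by have := C0; lra.
  have [N HN] := small _ (divr_gt0 e0 c1).
  exists N => m n Nm Nn.
  have [Gm xm] := Hvw m; have [Gn xn] := Hvw n.
  have /G_nrm := G_lin (-1) Gn Gm; rewrite !scaleN1r !(addrC (- _)) => /le_lt_trans;
    apply.
  have h3 := ler_nrm_dist x (vw m).1 (vw n).1; rewrite (nrmBC _ x) in h3.
  have h1 := lt_trans xm (HN m Nm); have h2 := lt_trans xn (HN n Nn).
  have d0 : 0 < e / (2 * C + 1) by rewrite divr_gt0.
  rewrite -[ltRHS](divfK (lt0r_neq0 c1)); set d := e / _ in h1 h2 d0 *.
  have /(ler_wpM2l C0) : nrm ((vw m).1 - (vw n).1) <= 2 * d by lra.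
  lra.
exists w => e e0; have [N HN] := small _ e0; have [M HM] := Hw _ e0.
have [Gn xn] := Hvw (maxn N M).
exists (vw (maxn N M)).1, (vw (maxn N M)).2; split => //.
  exact: lt_trans xn (HN _ (leq_maxl _ _)).
by rewrite nrmBC; apply: HM; exact: leq_maxr.
Qed.

(** [Gbar] is the closure of the graph spanned by the pairs [(p i, q i)]. The estimate [pq] makes it
    single-valued, and completeness of [W] makes it total. *)
Lemma bounded_extension :
  exists2 f : V -> W, bounded_by C f & forall i, f (p i) = q i.
Proof.
have [f fG] := choice Gbar_ex.
have f_unique x w : Gbar x w -> f x = w.
  move=> xw; apply/eqP; rewrite -subr_eq0; apply/eqP/nrm_le0.
  have := Gbar_nrm (Gbar_lin (-1) xw (fG x)).
  by rewrite !scaleN1r addNr nrm0 mulr0 addrC.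
exists f; first split => //.
- by move=> c x y; apply: f_unique; exact: Gbar_lin.
- by move=> x; exact: Gbar_nrm.
move=> i; apply: f_unique => e e0; exists (p i), (q i).
split; rewrite ?subrr ?nrm0 //.
by exists [:: (1, i)]; rewrite !big_seq1 /= !scale1r.
Qed.

End Extension.

(** * Slice maps on minimal tensor products *)

Section Slices.
Context (R : realType) (A B : cstarType R) (T : minTensor A B).
Implicit Types (a : A) (b : B) (x : T).

Lemma bdd_tens_eq (W : normedModType R[i]) (C D : R) (f g : T -> W) :
  bounded_by C f -> bounded_by D g ->
  (forall a b, f (a \ox b) = g (a \ox b)) -> forall x, f x = g x.
Proof.
move=> fC gD fg; apply: (bdd_dense (@tens_dense _ _ _ T) fC gD) => _ [a [b ->]].
exact: fg.
Qed.

Lemma tens_pair_dense :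
  dense (lin_span [set x | exists i : A * B, x = i.1 \ox i.2 :> T]).
Proof.
move=> O O0 oO; have [x [Ox [n [c [s [Ss xE]]]]]] := @tens_dense _ _ _ T O O0 oO.
exists x; split => //; exists n, c, s; split => // i.
by have [a [b ->]] := Ss i; exists (a, b).
Qed.

Lemma nrm_tensor (E F G : hilbertSpace R) (tau : {bilinear E -> F -> G}) (x : E) (y : F) :
  hilbert_tensor tau -> nrm (tau x y) = nrm x * nrm y.
Proof.
move=> [tauE _]; apply/eqP; rewrite -(@eqrXn2 _ 2) ?mulr_ge0 ?nrm_ge0 //.
apply/eqP/complexI; rewrite -hdotE tauE !hdotE -rmorphM /=; congr (_%:C).
by rewrite exprMn.
Qed.

(** Between vectors [e], [e'] of [pi] the slice has the coefficient [mu beta]; between vectors [f],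
    [f'] of [sigma], [beta] has the coefficient of [rho X] between [tau e f] and [tau e' f'].
    Isometry of [pi] and [sigma] turns these coefficients into norms. *)
Lemma nrm_slice_sumr (mu : B -> R[i]^o) (C : R) (l : seq (R[i] * (A * B))) :
  bounded_by C mu ->
  nrm (\sum_(t <- l) t.1 *: (mu t.2.2 *: t.2.1)) <=
  C * nrm (\sum_(t <- l) t.1 *: (t.2.1 \ox t.2.2 : T)).
Proof.
move=> muC; have C0 := bdd_ge0 muC; set X := \sum_(t <- l) _ *: (_ \ox _).
have [E [F [G [pi [sigma [rho [tau [piP sigP tauP rhoP rhoE]]]]]]]] := @tens_spatial
  _ _ _ T.
apply: (isometry_form piP) => [|e e']; first by rewrite mulr_ge0 ?nrm_ge0.
pose beta := \sum_(t <- l) (t.1 * hdot E (pi t.2.1 e) e') *: t.2.2.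
have -> : hdot E (pi (\sum_(t <- l) t.1 *: (mu t.2.2 *: t.2.1)) e) e' = mu beta.
  rewrite (bdd_sum muC) linear_sumlz linear_sumlz; apply: eq_bigr => t _.
  rewrite (bddZ muC) scalerA linearZl_LR linearZl_LR /=.
  by rewrite /GRing.scale /=; ring.
apply: le_trans (bdd_nrm muC _) _; rewrite -!mulrA ler_wpM2l // mulrA.
apply: (isometry_form sigP) => [|f f']; first by rewrite !mulr_ge0 ?nrm_ge0.
have -> : hdot F (sigma beta f) f' = hdot G (rho X (tau e f)) (tau e' f').
  rewrite /beta /X !linear_sumlz; apply: eq_bigr => t _.
  rewrite !linearZl_LR /= rhoE; case: tauP => -> _ /=.
  by rewrite /GRing.scale /=; ring.
apply: le_trans (hdot_CauchySchwarz _ _) _.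
have := nrm_rep rhoP X (tau e f); rewrite !(nrm_tensor _ _ tauP).
move=> /(ler_wpM2r (mulr_ge0 (nrm_ge0 e') (nrm_ge0 f'))) /le_trans; apply.
by rewrite le_eqVlt; apply/orP; left; apply/eqP; ring.
Qed.

Lemma nrm_slice_suml (nu : A -> R[i]^o) (C : R) (l : seq (R[i] * (A * B))) :
  bounded_by C nu ->
  nrm (\sum_(t <- l) t.1 *: (nu t.2.1 *: t.2.2)) <=
  C * nrm (\sum_(t <- l) t.1 *: (t.2.1 \ox t.2.2 : T)).
Proof.
move=> nuC; have C0 := bdd_ge0 nuC; set X := \sum_(t <- l) _ *: (_ \ox _).
have [E [F [G [pi [sigma [rho [tau [piP sigP tauP rhoP rhoE]]]]]]]] := @tens_spatial
  _ _ _ T.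
apply: (isometry_form sigP) => [|f f']; first by rewrite mulr_ge0 ?nrm_ge0.
pose alpha := \sum_(t <- l) (t.1 * hdot F (sigma t.2.2 f) f') *: t.2.1.
have -> : hdot F (sigma (\sum_(t <- l) t.1 *: (nu t.2.1 *: t.2.2)) f) f' = nu alpha.
  rewrite (bdd_sum nuC) linear_sumlz linear_sumlz; apply: eq_bigr => t _.
  rewrite (bddZ nuC) scalerA linearZl_LR linearZl_LR /=.
  by rewrite /GRing.scale /=; ring.
apply: le_trans (bdd_nrm nuC _) _; rewrite -!mulrA ler_wpM2l // mulrA.
apply: (isometry_form piP) => [|e e']; first by rewrite !mulr_ge0 ?nrm_ge0.
have -> : hdot E (pi alpha e) e' = hdot G (rho X (tau e f)) (tau e' f').
  rewrite /alpha /X !linear_sumlz; apply: eq_bigr => t _.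
  rewrite !linearZl_LR /= rhoE; case: tauP => -> _ /=.
  by rewrite /GRing.scale /=; ring.
apply: le_trans (hdot_CauchySchwarz _ _) _.
have := nrm_rep rhoP X (tau e f); rewrite !(nrm_tensor _ _ tauP).
move=> /(ler_wpM2r (mulr_ge0 (nrm_ge0 e') (nrm_ge0 f'))) /le_trans; apply.
by rewrite le_eqVlt; apply/orP; left; apply/eqP; ring.
Qed.

(* The slice maps [id (x) mu] and [nu (x) id]; junk when the functional is not
   bounded. *)
Definition slicer (mu : B -> R[i]^o) : T -> A :=
  xget (fun=> 0) [set S | (exists C, bounded_by C S) /\
                          forall a b, S (a \ox b) = mu b *: a].

Definition slicel (nu : A -> R[i]^o) : T -> B :=
  xget (fun=> 0) [set S | (exists C, bounded_by C S) /\
                          forall a b, S (a \ox b) = nu a *: b].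

Lemma slicerP (mu : B -> R[i]^o) C : bounded_by C mu ->
  bounded_by C (slicer mu) /\ forall a b, slicer mu (a \ox b) = mu b *: a.
Proof.
move=> muC; have [S SC SE] := bounded_extension
  (q := fun i : A * B => mu i.2 *: i.1) (bdd_ge0 muC) tens_pair_dense
  (fun l => nrm_slice_sumr l muC).
have SP : [set S | (exists C, bounded_by C S) /\
    forall a b, S (a \ox b : T) = mu b *: a] S.
  by split; [exists C|move=> a b; exact: SE (a, b)].
have [[D DC] DE] := xgetI (fun=> 0) SP.
split; last exact: DE.
(* The map chosen by [xget] comes with some bound [D] only; it agrees with [S] on elementary
   tensors, hence everywhere, and so has the bound [C]. *)
suff -> : slicer mu = S by [].
by apply/funext; apply: (bdd_tens_eq DC SC) => a b; rewrite DE (SE (a, b)).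
Qed.

Lemma slicelP (nu : A -> R[i]^o) C : bounded_by C nu ->
  bounded_by C (slicel nu) /\ forall a b, slicel nu (a \ox b) = nu a *: b.
Proof.
move=> nuC; have [S SC SE] := bounded_extension
  (q := fun i : A * B => nu i.1 *: i.2) (bdd_ge0 nuC) tens_pair_dense
  (fun l => nrm_slice_suml l nuC).
have SP : [set S | (exists C, bounded_by C S) /\
    forall a b, S (a \ox b : T) = nu a *: b] S.
  by split; [exists C|move=> a b; exact: SE (a, b)].
have [[D DC] DE] := xgetI (fun=> 0) SP.
split; last exact: DE.
suff -> : slicel nu = S by [].
by apply/funext; apply: (bdd_tens_eq DC SC) => a b; rewrite DE (SE (a, b)).
Qed.

End Slices.

Section MoreBounded.
Context (R : realType).

Lemma nlim0_sum (V : normedModType R[i]) n (c : 'I_n -> R[i]) (u : 'I_n -> nat -> V) :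
  (forall i, nlim (u i) 0) -> nlim (fun N => \sum_(i < n) c i *: u i N) 0.
Proof.
elim: n c u => [|n IH] c u u0.
  by move=> e e0; exists 0%N => N _; rewrite big_ord0 subrr nrm0.
have h1 : nlim (fun N => \sum_(i < n) c (lift ord0 i) *: u (lift ord0 i) N) 0.
  by apply: IH.
have h2 : nlim (fun N => c ord0 *: u ord0 N) 0.
  move=> e e0; set k := nrm (c ord0 : R[i]^o).
  have k1 : 0 < k + 1 by have := nrm_ge0 (c ord0 : R[i]^o); rewrite -/k; lra.
  have [N HN] := u0 ord0 _ (divr_gt0 e0 k1); exists N => m /HN.
  rewrite !subr0 nrmZ -/k ltr_pdivlMr // => h; apply: le_lt_trans h.
  by rewrite mulrC ler_wpM2l ?nrm_ge0 //; lra.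
have := nlimD h2 h1; rewrite addr0 => h e /h[N HN]; exists N => m /HN.
by rewrite big_ord_recl.
Qed.

Lemma bdd_cmull (A : cstarType R) (a : A) : bounded_by (nrm a) (cmul a).
Proof.
split=> [c x y||x]; rewrite ?nrm_ge0 ?ler_nrmM //.
by rewrite cmulDr cmulZr.
Qed.

Lemma bdd_cmulr (A : cstarType R) (a : A) : bounded_by (nrm a) (cmul^~ a).
Proof.
split=> [c x y||x]; rewrite ?nrm_ge0 //; first by rewrite cmulDl cmulZl.
by rewrite mulrC ler_nrmM.
Qed.

Context (A B : cstarType R).

Lemma bdd_starmorph (f : {starmorphism A -> B}) : bounded_by 1 f.
Proof.
split=> // [c x y|x]; first by rewrite linearP.
by rewrite mul1r nrm_starmorph.
Qed.

Lemma bdd_starconj (f : A -> B) C : bounded_by C f ->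
  bounded_by C (fun x => star (f (star x))).
Proof.
move=> fC; split=> [c x y||x]; last 2 first.
- exact: bdd_ge0 fC.
- by rewrite nrm_star -(nrm_star x); exact: bdd_nrm.
by rewrite starD starZ (bddD fC) (bddZ fC) starD starZ conjCK.
Qed.

Lemma bdd_rep (E : hilbertSpace R) (act : {bilinear A -> E -> E}) e e' :
  faithful_representation act ->
  bounded_by (nrm e * nrm e') (fun x => hdot E (act x e) e' : R[i]^o).
Proof.
move=> actP; split=> [c x y||x].
- by rewrite linearPl linearPl.
- by rewrite mulr_ge0 ?nrm_ge0.
- apply: le_trans (hdot_CauchySchwarz _ _) _.
  rewrite mulrAC ler_wpM2r ?nrm_ge0 // mulrC; exact: nrm_rep.
Qed.

Context (T : minTensor A B).

Definition legl (a : A) : T := a \ox 𝟏.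
Definition legr (b : B) : T := 𝟏 \ox b.

Fact legl_linear : linear legl.
Proof. by move=> c x y; rewrite /legl linearPl. Qed.
HB.instance Definition _ := GRing.isLinear.Build R[i] A T *:%R legl legl_linear.

Fact legl_morphM x y : legl (x ∙ y) = legl x ∙ legl y.
Proof. by rewrite /legl tensM cmul1l. Qed.
Fact legl_morph1 : legl 𝟏 = 𝟏.
Proof. exact: tens11. Qed.
Fact legl_morph_star x : legl (star x) = star (legl x).
Proof. by rewrite /legl tens_star star1. Qed.
HB.instance Definition _ := isStarMorphism.Build R A T legl
  legl_morphM legl_morph1 legl_morph_star.

Fact legr_linear : linear legr.
Proof. by move=> c x y; rewrite /legr linearPr. Qed.
HB.instance Definition _ := GRing.isLinear.Build R[i] B T *:%R legr legr_linear.

Fact legr_morphM x y : legr (x ∙ y) = legr x ∙ legr y.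
Proof. by rewrite /legr tensM cmul1l. Qed.
Fact legr_morph1 : legr 𝟏 = 𝟏.
Proof. exact: tens11. Qed.
Fact legr_morph_star x : legr (star x) = star (legr x).
Proof. by rewrite /legr tens_star star1. Qed.
HB.instance Definition _ := isStarMorphism.Build R B T legr
  legr_morphM legr_morph1 legr_morph_star.

Lemma tens_legs a b : a \ox b = legl a ∙ legr b.
Proof. by rewrite /legl /legr tensM cmul1l cmul1r. Qed.

Lemma legs_comm a b : legl a ∙ legr b = legr b ∙ legl a.
Proof. by rewrite /legl /legr !tensM !cmul1l !cmul1r. Qed.

Lemma nrm_tens a b : nrm (a \ox b : T) <= nrm a * nrm b.
Proof.
rewrite tens_legs; apply: le_trans (ler_nrmM _ _) _.
by apply: ler_pM; rewrite ?nrm_ge0 //; [exact: (nrm_starmorph legl)|exact: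
  (nrm_starmorph legr)].
Qed.

Lemma bdd_tensl (b : B) : bounded_by (nrm b) (fun a => a \ox b : T).
Proof.
split=> [c x y||x]; first by rewrite linearPl.
  exact: nrm_ge0.
by rewrite mulrC nrm_tens.
Qed.

Lemma slicer_mull (mu : B -> R[i]^o) C a (x : T) : bounded_by C mu ->
  slicer mu ((a \ox 𝟏) ∙ x) = a ∙ slicer mu x.
Proof.
move=> muC; have [SC SE] := slicerP T muC.
apply: (bdd_tens_eq (bdd_comp (bdd_cmull _) SC) (bdd_comp SC (bdd_cmull a))) => a' b' /=.
by rewrite tensM cmul1l !SE cmulZr.
Qed.

Lemma slicer_mulr (mu : B -> R[i]^o) C a (x : T) : bounded_by C mu ->
  slicer mu (x ∙ (a \ox 𝟏)) = slicer mu x ∙ a.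
Proof.
move=> muC; have [SC SE] := slicerP T muC.
apply: (bdd_tens_eq (bdd_comp (bdd_cmulr _) SC) (bdd_comp SC (bdd_cmulr a))) => a' b' /=.
by rewrite tensM cmul1r !SE cmulZl.
Qed.

Lemma slicer_mull2 (mu : B -> R[i]^o) C b (x : T) : bounded_by C mu ->
  slicer mu ((𝟏 \ox b) ∙ x) = slicer (mu \o cmul b) x.
Proof.
move=> muC; have [SC SE] := slicerP T muC.
have [SC' SE'] := slicerP T (bdd_comp (bdd_cmull b) muC).
apply: (bdd_tens_eq (bdd_comp (bdd_cmull _) SC) SC') => a' b' /=.
by rewrite tensM cmul1l SE SE'.
Qed.

Lemma slicer_add (mu nu : B -> R[i]^o) C D (x : T) : bounded_by C mu -> bounded_by D nu ->
  slicer (fun b => mu b + nu b) x = slicer mu x + slicer nu x.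
Proof.
move=> muC nuD; have [SC SE] := slicerP T muC; have [SD SE'] := slicerP T nuD.
have [SS SS'] := slicerP T (bdd_add muC nuD).
move: x; apply: (bdd_tens_eq SS (bdd_add SC SD)) => a b.
by rewrite SS' SE SE' scalerDl.
Qed.

Lemma slicer_scale (mu : B -> R[i]^o) C (k : R[i]) (x : T) : bounded_by C mu ->
  slicer (fun b => k *: mu b) x = k *: slicer mu x.
Proof.
move=> muC; have [SC SE] := slicerP T muC.
have [SS SS'] := slicerP T (bdd_scale k muC).
move: x; apply: (bdd_tens_eq SS (bdd_scale k SC)) => a b.
by rewrite SS' SE scalerA.
Qed.

End MoreBounded.

(** * Ergodicity of compact quantum groups *)

Section Convolution.
Context (R : realType) (mt : forall A B : cstarType R, minTensor A B).
Context (H : cstarType R) (Delta : {starmorphism H -> mt H H}).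
Hypothesis coass : coassociative Delta Delta.

(** For functions on a group, with [Delta x (s, t) = x (s t)], this averages the right translates of
    [x] against [mu]. *)
Definition convolve (mu : H -> R[i]^o) (x : H) : H := slicer mu (Delta x).

Lemma bdd_convolve mu C : bounded_by C mu -> bounded_by C (convolve mu).
Proof.
move=> muC; have [SC _] := slicerP (mt H H) muC.
by have := bdd_comp (bdd_starmorph Delta) SC; rewrite mulr1.
Qed.

(** Both sides are [id (x) nu (x) mu] applied to the twofold coproduct of [x]: [e2] computes it from
    one bracketing, [e1] from the other. *)
Lemma convolve_coass mu nu C D x : bounded_by C mu -> bounded_by D nu ->
  convolve nu (convolve mu x) = convolve (nu \o convolve mu) x.
Proof.
move=> muC nuD; have [F [G [alpha [FE GE alphaE co]]]] := coass.
have [Smu Smu'] := slicerP (mt H H) muC; have [Snu Snu'] := slicerP (mt H H) nuD.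
have nm := bdd_comp (bdd_convolve muC) nuD.
have [Snm Snm'] := slicerP (mt H H) nm.
have nS := bdd_comp Smu nuD.
have [T1 T1'] := slicerP (mt H (mt H H)) nS.
rewrite /convolve.
have e1 z : slicer (nu \o slicer mu) (G z) = slicer (nu \o convolve mu) z.
  apply: (bdd_tens_eq (bdd_comp (bdd_starmorph G) T1) Snm) => a b /=.
  by rewrite GE T1' Snm'.
have e3 (w : mt H H) b : slicer (nu \o slicer mu) (alpha (w \ox b)) = mu b *: slicer nu w.
  apply: (bdd_tens_eq (bdd_comp (bdd_tensl _ b) (bdd_comp (bdd_starmorph alpha) T1))
    (bdd_scale (mu b) Snu)) => c d /=.
  by rewrite alphaE T1' /= Smu' (bddZ nuD) Snu' scalerA.
have e2 z : slicer (nu \o slicer mu) (alpha (F z)) = slicer nu (Delta (slicer mu z)).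
  apply: (bdd_tens_eq (bdd_comp (bdd_starmorph F) (bdd_comp (bdd_starmorph alpha)
    T1)) (bdd_comp Smu (bdd_comp (bdd_starmorph Delta) Snu))) => a b /=.
  by rewrite FE e3 Smu' linearZ (bddZ Snu).
by rewrite -e2 co e1.
Qed.

End Convolution.

Section Ergodicity.
Context (R : realType) (mt : forall A B : cstarType R, minTensor A B).
Context (H : cstarType R) (Delta : {starmorphism H -> mt H H}).
Hypothesis coass : coassociative Delta Delta.
Context (E F G : hilbertSpace R) (pi : {bilinear H -> E -> E})
  (sigma : {bilinear H -> F -> F}) (rho : {bilinear mt H H -> G -> G})
  (tau : {bilinear E -> F -> G}).
Hypothesis piP : faithful_representation pi.
Hypothesis sigmaP : faithful_representation sigma.
Hypothesis rhoP : faithful_representation rho.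
Hypothesis rhoE : forall (a b : H) x y, rho (a \ox b) (tau x y) = tau (pi a x) (sigma
  b y).
Hypothesis tauP : hilbert_tensor tau.
Context (e : F).
Hypothesis e1 : nrm e = 1.

Let omega (x : H) : R[i]^o := hdot F (sigma x e) e.

Let omega_bdd : bounded_by 1 omega.
Proof. by have := bdd_rep e e sigmaP; rewrite e1 mulr1. Qed.

Let omega1 : omega 𝟏 = 1.
Proof. by case: sigmaP => _ _ s1 _ _; rewrite /omega s1 hdotE e1 expr1n. Qed.

Let omega_star x : omega (star x) = Num.conj (omega x : R[i]).
Proof.
by case: sigmaP => _ _ _ ss _; rewrite /omega ss starK (hdotC (sigma x e)).
Qed.

Let omega_starM x y : omega (star x ∙ y) = hdot F (sigma y e) (sigma x e).
Proof. by case: sigmaP => _ sM _ ss _; rewrite /omega sM ss starK. Qed.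

Let S := @slicer _ _ _ (mt H H) omega.

Let S_bdd : bounded_by 1 S.
Proof. by case: (slicerP (mt H H) omega_bdd). Qed.

Let SE a b : S (a \ox b) = omega b *: a.
Proof. by case: (slicerP (mt H H) omega_bdd). Qed.

Let S_star z : S (star z) = star (S z).
Proof.
apply: star_inj; rewrite starK; move: z.
apply: (bdd_tens_eq (bdd_starconj S_bdd) S_bdd) => a b.
by rewrite tens_star !SE starZ starK omega_star conjCK.
Qed.

(** Slicing by a vector state is compression to the vectors [tau x e]; this is how positivity passes
    through [S]. *)
Let S_form z x y : hdot E (pi (S z) x) y = hdot G (rho z (tau x e)) (tau y e).
Proof.
move: z; have := bdd_tens_eq (bdd_comp S_bdd (bdd_rep x y piP)) (bdd_rep (tau x e)
  (tau y e) rhoP).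
apply=> a b /=; rewrite SE linearZl_LR /= linearZl_LR rhoE.
by case: tauP => -> _; rewrite /GRing.scale /= mulrC.
Qed.

Let S_pos c : exists s, S (star c ∙ c) = star s ∙ s.
Proof.
apply: (pos_square piP) => [|x]; first by rewrite -S_star starM starK.
by rewrite /qform S_form -[complex.Re _]/(qform rho _ _) qform_starM ?sqr_ge0.
Qed.

Let Rc := convolve Delta omega.

Let Rc_bdd : bounded_by 1 Rc.
Proof. exact: bdd_convolve. Qed.

Let Rc1 : Rc 𝟏 = 𝟏.
Proof. by rewrite /Rc /convolve star_morph1 -(tens11 (mt H H)) -/S SE omega1 scale1r. Qed.

Let Rc_star x : Rc (star x) = star (Rc x).
Proof. by rewrite /Rc /convolve star_morph_star -/S S_star. Qed.

Let Rc_pos s : exists s', Rc (star s ∙ s) = star s' ∙ s'.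
Proof. by rewrite /Rc /convolve star_morphM star_morph_star; exact: S_pos. Qed.

Let it n := iter n Rc.

Let it_bdd n : bounded_by 1 (it n).
Proof.
elim: n => [|n IH]; first exact: bdd_id.
by have := bdd_comp IH Rc_bdd; rewrite mulr1.
Qed.

(** Cesaro means of the powers of [Rc]. They commute with [Rc], and [Rc (B N x) - B N x] telescopes
    to order [1/N]. *)
Let B (N : nat) x := (N.+1%:R^-1 : R)%:C *: \sum_(n < N.+1) it n x.

Let B_bdd N : bounded_by 1 (B N).
Proof.
split=> [c x y||x] //.
- rewrite /B scalerA mulrC -scalerA -scalerDr; congr (_ *: _);
    rewrite scaler_sumr -big_split /=.
  by apply: eq_bigr => n _; rewrite (bddD (it_bdd n)) (bddZ (it_bdd n)).
- rewrite /B nrmZR ger0_norm ?invr_ge0 // mul1r mulrC ler_pdivrMr ?ltr0n //.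
  apply: le_trans (ler_nrm_sum _ _ _) _.
  apply: (@le_trans _ _ (\sum_(n < N.+1) nrm x)).
    by apply: ler_sum => n _; have := bdd_nrm (it_bdd n) x; rewrite mul1r.
  by rewrite sumr_const card_ord mulr_natr.
Qed.

Let BRc N x : B N (Rc x) = Rc (B N x).
Proof.
rewrite /B (bddZ Rc_bdd) (bdd_sum Rc_bdd); congr (_ *: _); apply: eq_bigr => n _.
by rewrite /it -iterSr iterS.
Qed.

Let B_fix N x : Rc x = x -> B N x = x.
Proof.
move=> Rx; rewrite /B (eq_bigr (fun=> x)); last first.
  by move=> n _; rewrite /it; elim: (nat_of_ord n) => //= k ->.
rewrite sumr_const card_ord -(scaler_nat N.+1 x) scalerA.
have -> : (N.+1%:R : R[i]) = (N.+1%:R : R)%:C by rewrite rmorph_nat.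
by rewrite -rmorphM /= mulVf ?pnatr_eq0 // scale1r.
Qed.

Let B_star N x : B N (star x) = star (B N x).
Proof.
rewrite /B starZR star_sum; congr (_ *: _); apply: eq_bigr => n _.
by rewrite /it; elim: (nat_of_ord n) => //= k ->; rewrite Rc_star.
Qed.

Let Rc_B N x : nrm (Rc (B N x) - B N x) <= 2 * N.+1%:R^-1 * nrm x.
Proof.
rewrite /B (bddZ Rc_bdd) (bdd_sum Rc_bdd) -scalerBr nrmZR ger0_norm ?invr_ge0 //.
rewrite -[_ * _ * _]mulrA mulrCA ler_wpM2l ?invr_ge0 //.
rewrite -sumrB -(big_mkord xpredT (fun n => it n.+1 x - it n x)) telescope_sumr //.
apply: le_trans (ler_nrmB _ _) _.
by have := bdd_nrm (it_bdd N.+1) x; rewrite /it /=; lra.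
Qed.

Let omega_B_pos N s : 0 <= (omega (B N (star s ∙ s)) : R[i]).
Proof.
rewrite /B (bddZ omega_bdd) (bdd_sum omega_bdd).
rewrite mulr_ge0 ?ler0c ?invr_ge0 //; apply: sumr_ge0 => n _.
have [s' ->] : exists s', it n (star s ∙ s) = star s' ∙ s'.
  elim: (nat_of_ord n) => [|k [s' IH]]; first by exists s.
  by rewrite /it /= -/(it k _) IH; exact: Rc_pos.
by rewrite omega_starM hdotE ler0c sqr_ge0.
Qed.

Let convolve_it n mu C x : bounded_by C mu ->
  convolve Delta mu (it n x) = convolve Delta (mu \o it n) x.
Proof.
elim: n mu C => [|n IH] mu C muC //.
rewrite /it /= -/(it n x) /Rc (convolve_coass coass _ omega_bdd muC).
by rewrite (IH _ _ (bdd_comp Rc_bdd muC)).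
Qed.

Let convolve_B N mu C x : bounded_by C mu ->
  convolve Delta mu (B N x) = convolve Delta (mu \o B N) x.
Proof.
move=> muC.
have U_bdd M : exists D, bounded_by D (fun y => \sum_(n < M) it n y).
  elim: M => [|M [D IH]].
    by exists 0; split=> [c y z||y]; rewrite ?big_ord0 ?scaler0 ?addr0 ?nrm0 ?mul0r.
  exists (D + 1); have := bdd_add IH (it_bdd M).
  by congr bounded_by; apply/funext => y; rewrite big_ord_recr.
have H1 M : convolve Delta mu (\sum_(n < M) it n x) =
    convolve Delta (fun y => mu (\sum_(n < M) it n y)) x.
  elim: M => [|M IH].
    rewrite big_ord0 (bdd0 (bdd_convolve Delta muC)).
    have z0 : bounded_by 0 (fun y : H => mu (\sum_(n < 0) it n y)).
      by split=> [c y z||y]; rewrite ?big_ord0 ?(bdd0 muC) ?scaler0 ?addr0 ?nrm0 ?mul0r.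
    apply/esym/nrm_le0; have := bdd_nrm (bdd_convolve Delta z0) x.
    by rewrite mul0r.
  have [D UD] := U_bdd M.
  rewrite big_ord_recr /= (bddD (bdd_convolve Delta muC)) IH (convolve_it _ _ muC).
  rewrite /convolve -(slicer_add _ (bdd_comp UD muC) (bdd_comp (it_bdd M) muC)) /=.
  by congr slicer; apply/funext => y; rewrite big_ord_recr /= (bddD muC).
have [D UD] := U_bdd N.+1.
rewrite /B (bddZ (bdd_convolve Delta muC)) H1 /convolve.
rewrite -(slicer_scale _ _ (bdd_comp UD muC)).
by congr slicer; apply/funext => y /=; rewrite (bddZ muC).
Qed.

(** A state that is invariant under [Rc] up to an error of order [1/N]. *)
Let eta N (x : H) : R[i]^o := omega (B N x).

Let eta_bdd N : bounded_by 1 (eta N).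
Proof. by have := bdd_comp (B_bdd N) omega_bdd; rewrite mulr1. Qed.

Let eta_Rc N x : nrm (eta N (Rc x) - eta N x) <= 2 * N.+1%:R^-1 * nrm x.
Proof.
rewrite /eta -(bddB omega_bdd) BRc.
by apply: le_trans (bdd_nrm omega_bdd _) _; rewrite mul1r Rc_B.
Qed.

(** The product functional of [eta N] and [omega]. *)
Let theta N (z : mt H H) : R[i]^o := eta N (S z).

Let theta_bdd N : bounded_by 1 (theta N).
Proof. by have := bdd_comp S_bdd (eta_bdd N); rewrite mulr1. Qed.

Let theta_pos N c : 0 <= (theta N (star c ∙ c) : R[i]).
Proof. by rewrite /theta /eta; have [s ->] := S_pos c; exact: omega_B_pos. Qed.

Let theta_star N z : theta N (star z) = Num.conj (theta N z : R[i]).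
Proof. by rewrite /theta /eta S_star B_star omega_star. Qed.

(* Cauchy-Schwarz, from the positivity of [theta] at [r c^* - conj (theta (c v)) v]. *)
Let theta_CauchySchwarz N c v (r : R) : 0 < r ->
  nrm (theta N (star v ∙ v)) <= r -> nrm (theta N (c ∙ v)) ^+ 2 <= r * nrm c ^+ 2.
Proof.
move=> r0 vr; set p : R[i] := theta N (c ∙ v).
pose w := r%:C *: star c - Num.conj p *: v.
have := theta_pos N w.
have tv : theta N (star v ∙ v) = (nrm (theta N (star v ∙ v)))%:C :> R[i].
  by rewrite -nrmE ger0_norm // theta_pos.
have tc : theta N (c ∙ star c) = (nrm (theta N (c ∙ star c)))%:C :> R[i].
  by rewrite -nrmE ger0_norm // -{1}(starK c) theta_pos.
have pE : p * Num.conj p = (nrm (p : R[i]^o) ^+ 2)%:C.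
  by rewrite rmorphXn /= -nrmE normCK.
have pE' : theta N (star v ∙ star c) = Num.conj p by rewrite -starM theta_star.
have tcle : nrm (theta N (c ∙ star c)) <= nrm c ^+ 2.
  apply: le_trans (bdd_nrm (theta_bdd N) _) _.
  by rewrite mul1r -{1}(starK c) nrm_starM nrm_star.
have -> : theta N (star w ∙ w) = (r ^+ 2)%:C * theta N (c ∙ star c)
    - (2 * r)%:C * (p * Num.conj p) + (p * Num.conj p) * theta N (star v ∙ v) :> R[i].
  rewrite /w starB starZR starK starZ conjCK cmulBl !cmulBr !cmulZl !cmulZr !scalerA.
  rewrite !(bddB (theta_bdd N)) !(bddZ (theta_bdd N)) pE' -/p /GRing.scale /=.
  rewrite rmorphXn rmorphM /= rmorph_nat; ring.
rewrite tv tc pE -!rmorphM -rmorphB -rmorphD /= ler0c.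
move: tcle vr; set P := nrm (p : R[i]^o); set a := nrm (theta N (c ∙ star c));
  set b := nrm (theta N (star v ∙ v)) => tcle vr h.
have P0 : 0 <= P ^+ 2 by exact: sqr_ge0.
have h1 : r ^+ 2 * a <= r ^+ 2 * nrm c ^+ 2 by rewrite ler_wpM2l ?sqr_ge0.
have h2 : P ^+ 2 * b <= P ^+ 2 * r by rewrite ler_wpM2l.
(* Positivity at [w] reads [2 r P^2 <= r^2 a + P^2 b], with [a <= (nrm c)^2] and [b <= r]. The bound
   [r] can be divided by, whereas [b] may vanish. *)
rewrite -(ler_pM2l r0); lra.
Qed.

(* [y] is nearly harmonic: [Rc y - y] and hence [Delta y - y \ox 1] in the
   seminorm of [theta] tend to [0]. *)
Let y N x := Rc (B N x).

Let y_nrm N x : nrm (y N x) <= nrm x.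
Proof. by have := bdd_nrm (bdd_comp (B_bdd N) Rc_bdd) x; rewrite mulr1 mul1r. Qed.

Let y_Rc N x : nrm (Rc (y N x) - y N x) <= 2 * N.+1%:R^-1 * nrm x.
Proof.
rewrite /y -BRc; apply: le_trans (Rc_B _ _) _.
rewrite ler_wpM2l ?mulr_ge0 ?invr_ge0 //.
by have := bdd_nrm Rc_bdd x; rewrite mul1r.
Qed.

Let S_mull a z : S ((a \ox 𝟏) ∙ z) = a ∙ S z.
Proof. exact: slicer_mull omega_bdd. Qed.

Let S_mulr a z : S (z ∙ (a \ox 𝟏)) = S z ∙ a.
Proof. exact: slicer_mulr omega_bdd. Qed.

Let S_mull2 d z : S ((𝟏 \ox d) ∙ z) = slicer (omega \o cmul d) z.
Proof. exact: slicer_mull2 omega_bdd. Qed.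

Let v N x := Delta (y N x) - (y N x \ox 𝟏).

(** With [z = y N x], slicing leaves three terms: [Rc (star z ∙ z) - star z ∙ z], on which [eta N]
    is small by near invariance, and two products containing [Rc z - z] or its adjoint, small in
    norm. Each one contributes [2 / (N + 1)], whence the [6]. *)
Let theta_small N x : nrm (theta N (star (v N x) ∙ v N x)) <= 6 * N.+1%:R^-1 * nrm x ^+ 2.
Proof.
set k : R := N.+1%:R^-1; have k0 : 0 <= k by rewrite invr_ge0.
rewrite /v; set z := y N x; set w := _ - _.
have Sv : S (star w ∙ w) = (Rc (star z ∙ z) - star z ∙ z)
    - (Rc (star z) - star z) ∙ z - star z ∙ (Rc z - z).
  rewrite /w starB tens_star star1 -star_morph_star cmulBl !cmulBr -star_morphM.
  rewrite tensM cmul1l !(bddB S_bdd) S_mull S_mulr SE omega1 scale1r.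
  rewrite -![S (Delta _)]/(Rc _); congr (_ - _).
  by rewrite cmulBl opprB addrA subrK.
rewrite /theta Sv !(bddB (eta_bdd N)).
have zx := y_nrm N x; rewrite -/z in zx.
have zRc := y_Rc N x; rewrite -/z -/k in zRc.
have zsRc : nrm (Rc (star z) - star z) <= 2 * k * nrm x.
  by rewrite Rc_star -starB nrm_star.
have := ler_nrmB (eta N (Rc (star z ∙ z)) - eta N (star z ∙ z) - eta N ((Rc (star z)
  - star z) ∙ z)) (eta N (star z ∙ (Rc z - z))).
have := ler_nrmB (eta N (Rc (star z ∙ z)) - eta N (star z ∙ z)) (eta N ((Rc (star z)
  - star z) ∙ z)).
have := eta_Rc N (star z ∙ z); rewrite nrm_starM -/k.
have := bdd_nrm (eta_bdd N) ((Rc (star z) - star z) ∙ z); rewrite mul1r.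
have := bdd_nrm (eta_bdd N) (star z ∙ (Rc z - z)); rewrite mul1r.
have := ler_nrmM (Rc (star z) - star z) z; have := ler_nrmM (star z) (Rc z - z).
rewrite nrm_star.
have h1 : nrm z * nrm (Rc z - z) <= nrm x * (2 * k * nrm x).
  by apply: ler_pM; rewrite ?nrm_ge0.
have h2 : nrm (Rc (star z) - star z) * nrm z <= 2 * k * nrm x * nrm x.
  by apply: ler_pM; rewrite ?nrm_ge0.
have h3 : 2 * k * nrm z ^+ 2 <= 2 * k * nrm x ^+ 2.
  by rewrite ler_wpM2l ?mulr_ge0 // ler_sqr ?nnegrE ?nrm_ge0.
rewrite expr2 in h3 *; lra.
Qed.

(* A difference of product functionals, small on [(a \ox 1) Delta x] by
   harmonicity and so, by density, on [1 \ox h]. *)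
Let Lambda N (d : H) (z : mt H H) : R[i]^o :=
  eta N (slicer (omega \o cmul d \o Rc \o B N) z)
  - (omega d : R[i]) *: eta N (slicer (omega \o B N) z).

Let omegad_bdd d : bounded_by (nrm d) (omega \o cmul d).
Proof. by have := bdd_comp (bdd_cmull d) omega_bdd; rewrite mul1r. Qed.

Let omegadB_bdd N d : bounded_by (nrm d) (omega \o cmul d \o Rc \o B N).
Proof.
by have := bdd_comp (B_bdd N) (bdd_comp Rc_bdd (omegad_bdd d)); rewrite !mulr1.
Qed.

Let omegaB_bdd N : bounded_by 1 (omega \o B N).
Proof. by have := bdd_comp (B_bdd N) omega_bdd; rewrite mulr1. Qed.

Let Lambda_bdd N d : bounded_by (2 * nrm d) (Lambda N d).
Proof.
have [S1 _] := slicerP (mt H H) (omegadB_bdd N d).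
have [S2 _] := slicerP (mt H H) (omegaB_bdd N).
have := bdd_add (bdd_comp S1 (eta_bdd N)) (bdd_scale (- (omega d : R[i])) (bdd_comp
  S2 (eta_bdd N))).
rewrite !mulr1 mul1r => h; apply: bdd_weaken (_ : _ <= 2 * nrm d) _; last first.
  by move: h; congr bounded_by; apply/funext => z; rewrite /Lambda /= scaleNr.
have := bdd_nrm omega_bdd d; rewrite mul1r (nrmN (omega d)); lra.
Qed.

(** Coassociativity moves [Rc] and [B N] from the functionals onto [x]. In the second term [omega]
    itself acts on [B N x] as [Rc]; the explicit [Rc] of the first term matches it, so that both
    terms involve the same [y N x]. *)
Let Lambda_Delta N d a x :
  Lambda N d ((a \ox 𝟏) ∙ Delta x) = theta N ((a \ox d) ∙ v N x).
Proof.
rewrite /Lambda (slicer_mull _ _ (omegadB_bdd N d)) (slicer_mull _ _ (omegaB_bdd N)).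
rewrite -[slicer _ (Delta x)]/(convolve Delta ((omega \o cmul d \o Rc) \o B N) x).
have oR := bdd_comp Rc_bdd (omegad_bdd d); rewrite mulr1 in oR.
rewrite -(convolve_B _ _ oR) -(convolve_coass coass _ omega_bdd (omegad_bdd d)).
rewrite -[slicer _ (Delta x)]/(convolve Delta (omega \o B N) x) -(convolve_B _ _
  omega_bdd).
rewrite -[convolve Delta omega _]/(y N x).
rewrite /theta /v cmulBr (bddB S_bdd) (bddB (eta_bdd N)).
have -> : a \ox d = (a \ox 𝟏) ∙ (𝟏 \ox d) :> mt H H by rewrite tensM cmul1l cmul1r.
rewrite -!cmulA !S_mull !S_mull2.
have [_ ->] := slicerP (mt H H) (omegad_bdd d).
by rewrite /= cmul1r cmulZr (bddZ (eta_bdd N)).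
Qed.

Let Lambda_lim d a x : nlim (fun N => Lambda N d ((a \ox 𝟏) ∙ Delta x)) 0.
Proof.
move=> r r0.
(* The summand [1] keeps the bound on [theta N (star v ∙ v)] positive when [x = 0], as the
   Cauchy-Schwarz inequality above demands. *)
set K := nrm (a \ox d : mt H H) ^+ 2 * (6 * (nrm x ^+ 2 + 1)).
have K0 : 0 <= K.
  by rewrite mulr_ge0 ?sqr_ge0 // mulr_ge0 // addr_ge0 // sqr_ge0.
have r20 : 0 < r ^+ 2 by rewrite exprn_gt0.
have [M HM] : exists M : nat, K / r ^+ 2 < M%:R.
  by exists (Num.Def.archi_bound (K / r ^+ 2)); apply: archi_boundP;
    rewrite divr_ge0 // ltW.
exists M => N MN; rewrite subr0 Lambda_Delta.
set k : R := N.+1%:R^-1; have k0 : 0 < k by rewrite invr_gt0.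
have s0 : 0 < 6 * k * (nrm x ^+ 2 + 1).
  by rewrite mulr_gt0 ?mulr_gt0 // ltr_wpDl ?sqr_ge0.
have h := @theta_CauchySchwarz N (a \ox d) (v N x) _ s0.
rewrite -(@ltr_pXn2r _ 2) ?nnegrE ?nrm_ge0 ?ltW //; apply: le_lt_trans (h _) _.
  by apply: le_trans (theta_small N x) _; rewrite ler_pM2l ?mulr_gt0 // lerDl.
have -> : 6 * k * (nrm x ^+ 2 + 1) * nrm (a \ox d : mt H H) ^+ 2 = K * k
  by rewrite /K; ring.
rewrite ltr_pdivrMr ?ltr0n // mulrC -ltr_pdivrMr //.
by apply: lt_trans HM _; rewrite ltr_nat ltnS.
Qed.

Hypothesis Delta_dense :
  dense (lin_span [set x : mt H H | exists h k, x = (h \ox 𝟏) ∙ Delta k]).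

(** For fixed [h], [Lambda N d (𝟏 \ox h)] is the difference of the two sides, whatever [N] is. The
    bound on [Lambda N d] is uniform in [N], so approximating [𝟏 \ox h] by a combination on which
    [Lambda] tends to [0] forces the difference to vanish. *)
Let omega_mul h d : Delta h = h \ox 𝟏 ->
  omega (d ∙ h) = (omega d : R[i]) * (omega h : R[i]) :> R[i].
Proof.
move=> hfix; have Rh : Rc h = h by rewrite /Rc /convolve hfix -/S SE omega1 scale1r.
have L1 N : Lambda N d (𝟏 \ox h) = omega (d ∙ h) - (omega d : R[i]) *: omega h.
  rewrite /Lambda.
  have [_ ->] := slicerP (mt H H) (omegadB_bdd N d).
  have [_ ->] := slicerP (mt H H) (omegaB_bdd N).
  have eta1 : eta N 𝟏 = 1 by rewrite /eta B_fix.
  by rewrite !(bddZ (eta_bdd N)) eta1 /= !B_fix // Rh /GRing.scale /= !mulr1.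
apply/eqP; rewrite -subr_eq0; apply/eqP.
rewrite -[LHS]/(omega (d ∙ h) - (omega d : R[i]) *: omega h).
apply: (@nrm_le0 _ R[i]^o); apply: (@le_eps _ _ _ (2 * nrm d + 1)) => r r0; rewrite add0r.
have [z [n [c [s [Ss zE]]]] xz] := dense_nrm Delta_dense (𝟏 \ox h) r0.
have : nlim (fun N => Lambda N d z) 0.
  have slim i : nlim (fun N => Lambda N d (s i)) 0.
    by have [a [x ->]] := Ss i; exact: Lambda_lim.
  move=> e0 /(nlim0_sum c slim)[N HN]; exists N => m /HN.
  suff -> : Lambda m d z = \sum_(i < n) c i *: Lambda m d (s i) by [].
  rewrite zE (bdd_sum (Lambda_bdd m d)); apply: eq_bigr => i _.
  exact: bddZ (Lambda_bdd m d) _ _.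
move=> /(_ _ r0)[N /(_ N (leqnn N))]; rewrite subr0 => Lz.
rewrite -(L1 N) -(subrK z (𝟏 \ox h)) (bddD (Lambda_bdd N d)).
apply: le_trans (ler_nrmD _ _) _; have := bdd_nrm (Lambda_bdd N d) (𝟏 \ox h - z).
have := nrm_ge0 d; move: xz Lz; set a := nrm (_ - z); set b := nrm _;
  set c' := nrm _; set d' := nrm d; nra.
Qed.

(** [omega_mul] at [d = star h] is the equality case of Cauchy-Schwarz for [sigma h e] and [e]. *)
Lemma fixed_eigenvector h : Delta h = h \ox 𝟏 ->
  sigma h e = hdot F (sigma h e) e *: e.
Proof.
move=> hfix; set l := hdot F (sigma h e) e.
have H1 : hdot F (sigma h e) (sigma h e) = Num.conj l * l.
  by rewrite -omega_starM (omega_mul _ hfix) omega_star.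
have ee : hdot F e e = 1 by rewrite hdotE e1 expr1n.
have H2 : hdot F (sigma h e - l *: e) (sigma h e - l *: e) = 0.
  rewrite linearBl !linearBr /= !linearZl_LR !linearZr_LR /= H1 ee (hdotC (sigma h e)
    e) -/l.
  by rewrite /GRing.scale /=; ring.
apply/eqP; rewrite -subr_eq0; apply/eqP/nrm0_eq0/eqP.
by rewrite -sqrf_eq0; apply/eqP/complexI; rewrite -hdotE H2.
Qed.

End Ergodicity.

Section ErgodicScalar.
Context (R : realType) (mt : forall A B : cstarType R, minTensor A B).
Context (H : cstarType R) (Delta : {starmorphism H -> mt H H}).

(** A vector [z] orthogonal to [e0] has the eigenvalue of [e0], as pairing [f (e0 + z)] with [e0]
    shows; any [x] splits along [e0] and its complement. *)
Lemma eigen_scalar (F : hilbertSpace R) (f : F -> F) :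
  (forall c x y, f (c *: x + y) = c *: f x + f y) ->
  (forall x, nrm x = 1 -> f x = hdot F (f x) x *: x) ->
  exists c : R[i], forall x, f x = c *: x.
Proof.
move=> flin feig.
have f0 : f 0 = 0 by have := flin (-1) 0 0; rewrite scaler0 addr0 scaleN1r addNr.
have fZ c x : f (c *: x) = c *: f x by have := flin c x 0; rewrite f0 !addr0.
have fD x y : f (x + y) = f x + f y by have := flin 1 x y; rewrite !scale1r.
have eig x : exists c : R[i], f x = c *: x.
  have [->|/eqP/nrm_gt0 x0] := eqVneq x 0; first by exists 0; rewrite f0 scaler0.
  have := feig ((nrm x)^-1%:C *: x); rewrite nrmZR ger0_norm ?invr_ge0 ?nrm_ge0 //
    mulVf ?gt_eqF //.
  move=> /(_ erefl); rewrite fZ; set c := hdot F _ _ => H1; exists c.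
  have := congr1 (fun y => (nrm x)%:C *: y) H1.
  rewrite (scalerA c) (mulrC c) -scalerA !(scalerA (nrm x)%:C) -rmorphM mulfV ?gt_eqF //.
  by rewrite !scale1r.
have [Fz|] := pselect (forall x : F, x = 0).
  by exists 0 => x; rewrite (Fz x) f0 scaler0.
move=> /existsNP[e0 /nrm_gt0 e0n].
have [l fe0] := eig e0; exists l => x.
have perp z : hdot F z e0 = 0 -> f z = l *: z.
  move=> ze0; have [m fz] := eig z; have [k fk] := eig (e0 + z).
  have HD u w : hdot F (u + w) e0 = hdot F u e0 + hdot F w e0 by exact: linearDl.
  have HZ c u : hdot F (c *: u) e0 = c * hdot F u e0 by exact: linearZl_LR.
  have : hdot F (f (e0 + z)) e0 = hdot F (f e0) e0 + hdot F (f z) e0 by rewrite fD HD.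
  rewrite fk fz fe0 !HZ HD ze0 mulr0 !addr0 hdotE.
  have n0 : (nrm e0 ^+ 2)%:C != 0 :> R[i].
    by apply/eqP => /complexI/eqP; rewrite sqrf_eq0 gt_eqF.
  move=> /(mulIf n0) kl.
  have := fk.
  by rewrite fD fe0 fz kl scalerDr => /addrI.
pose c := hdot F x e0 / (nrm e0 ^+ 2)%:C.
rewrite -(subrK (c *: e0) x) fD fZ fe0 perp.
  by rewrite [in RHS]scalerDr !scalerA (mulrC c).
rewrite linearBl linearZl_LR /= hdotE /GRing.scale /= /c divfK ?subrr //.
by apply/eqP => /complexI/eqP; rewrite sqrf_eq0 gt_eqF.
Qed.

Lemma fixed_scalar h : coassociative Delta Delta ->
  dense (lin_span [set x : mt H H | exists h k, x = (h \ox 𝟏) ∙ Delta k]) ->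
  Delta h = h \ox 𝟏 -> exists c : R[i], h = c *: 𝟏.
Proof.
move=> coass dens hfix.
have [E [F [G [pi [sigma [rho [tau [piP sigP tauP rhoP rhoE]]]]]]]] := @tens_spatial
  _ _ _ (mt H H).
have [|x x1|c cE] := @eigen_scalar F (sigma h).
- by move=> c x y; rewrite linearPr.
- exact: (fixed_eigenvector coass piP sigP rhoP rhoE tauP x1 dens hfix).
exists c; apply/eqP; rewrite -subr_eq0; apply/eqP/(rep_inj sigP) => x.
rewrite linearBl linearZl_LR /= cE; case: sigP => _ _ -> _ _.
by rewrite subrr.
Qed.

End ErgodicScalar.

(** * Fixed points of [id (x) Delta] *)

Section FixedPoints.
Context (R : realType).

(** Slices by the coefficients of [pi] determine the coefficients of [rho w] between elementary
    tensors, which span a dense subspace. *)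
Lemma slicel_sep (A B : cstarType R) (T : minTensor A B) (w : T) :
  (forall (nu : A -> R[i]^o) C, bounded_by C nu -> slicel nu w = 0) -> w = 0.
Proof.
move=> w0.
have [E [F [G [pi [sigma [rho [tau [piP sigP tauP rhoP rhoE]]]]]]]] := @tens_spatial
  _ _ _ T.
have coef e e' f f' : hdot G (rho w (tau e f)) (tau e' f') = 0.
  have nuB := bdd_rep e e' piP; have [nuS nuE] := slicelP T nuB.
  have := bdd_tens_eq (bdd_comp nuS (bdd_rep f f' sigP)) (bdd_rep (tau e f) (tau e'
    f') rhoP).
  move=> /(_ _ w) <-; first by rewrite /= (w0 _ _ nuB) linear0l linear0l.
  move=> a b /=; rewrite nuE linearZl_LR /= linearZl_LR rhoE.
  by case: tauP => -> _; rewrite /GRing.scale.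
have [_ taud] := tauP.
have zero_bdd (V W : normedModType R[i]) : bounded_by 0 (fun _ : V => 0 : W).
  by split=> [c x y||x]; rewrite ?scaler0 ?addr0 ?nrm0 ?mul0r.
have rho0 e f : rho w (tau e f) = 0.
  apply: hdot_eq0 => g; rewrite hdotC.
  have b1 : bounded_by (nrm (rho w (tau e f)))
      (fun g => hdot G g (rho w (tau e f)) : R[i]^o).
    split=> [c x y||x]; [by rewrite linearPl|exact: nrm_ge0|].
    by rewrite mulrC hdot_CauchySchwarz.
  rewrite (bdd_dense taud b1 (zero_bdd _ _)) ?conjC0 // => _ [x [y ->]].
  by rewrite hdotC coef conjC0.
apply: (rep_inj rhoP) => g.
have b1 : bounded_by (nrm w) (rho w).
  split=> [c x y||x]; [by rewrite linearPr|exact: nrm_ge0|exact: nrm_rep].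
by rewrite (bdd_dense taud b1 (zero_bdd _ _)) // => _ [x [y ->]].
Qed.

Context (mt : forall A B : cstarType R, minTensor A B).
Context (A H : cstarType R) (Delta : {starmorphism H -> mt H H}).
Hypothesis HP : compact_quantum_group Delta.

(** Each [slicel nu x] is fixed by translation in [H], hence scalar by ergodicity. For a functional
    [w0] with [w0 𝟏 = 1], the elements [x] and [slicer w0 x \ox 𝟏] then have the same slices. *)
Lemma fixed_leg (G : {starmorphism mt A H -> mt A (mt H H)})
    (alpha : {starmorphism mt (mt A H) H -> mt A (mt H H)}) (x : mt A H) :
  is_tensor_map id Delta G -> is_associator alpha ->
  G x = alpha (x \ox 𝟏) -> exists y, x = y \ox 𝟏.
Proof.
move=> GE alphaE xfix.
have [_ coass dens _] := HP.
have slice_fix (nu : A -> R[i]^o) C : bounded_by C nu ->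
    exists c : R[i], slicel nu x = c *: 𝟏.
  move=> nuC; have [S SE] := slicelP (mt A H) nuC; have [S' SE'] := slicelP (mt A (mt
    H H)) nuC.
  apply: (fixed_scalar coass dens).
  have h1 z : slicel nu (G z) = Delta (slicel nu z).
    apply: (bdd_tens_eq (bdd_comp (bdd_starmorph G) S') (bdd_comp S (bdd_starmorph
      Delta))) => a b /=.
    by rewrite GE SE' SE linearZ.
  have h2 z : slicel nu (alpha (z \ox 𝟏)) = slicel nu z \ox 𝟏.
    apply: (bdd_tens_eq (bdd_comp (bdd_tensl _ 𝟏) (bdd_comp (bdd_starmorph alpha)
      S')) (bdd_comp S (bdd_tensl _ 𝟏))) => a b /=.
    by rewrite alphaE SE' SE linearZl_LR.
  by rewrite -h1 xfix h2.
have [E [F [G' [pi [sigma [rho [tau [piP sigP tauP rhoP rhoE]]]]]]]] := @tens_spatial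
  _ _ _ (mt H H).
(* If the space [F] is zero, then so is [H], and no normalized functional exists. *)
have [F0|] := pselect (forall f : F, f = 0).
  exists 0; rewrite linear0l -(cmul1r x) -(tens11 (mt A H)).
  have -> : (𝟏 : H) = 0 by apply: (rep_inj sigP) => f; rewrite (F0 (sigma _ _)).
  by rewrite linear0r cmul0r.
move=> /existsNP[f0 /nrm_gt0 f0n].
pose w0 (h : H) : R[i]^o := ((nrm f0 ^+ 2)^-1)%:C *: (hdot F (sigma h f0) f0 : R[i]^o).
have [D w0B] : exists D, bounded_by D w0.
  by eexists; exact: (bdd_scale _ (bdd_rep f0 f0 sigP)).
have w01 : w0 𝟏 = 1.
  case: sigP => _ _ s1 _ _; rewrite /w0 s1 hdotE /GRing.scale /= -rmorphM /= mulVf //.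
  by rewrite sqrf_eq0 gt_eqF.
have [W WE] := slicerP (mt A H) w0B.
exists (slicer w0 x); apply/eqP; rewrite -subr_eq0; apply/eqP/slicel_sep => nu C nuC.
have [S SE] := slicelP (mt A H) nuC.
have [c cE] := slice_fix _ _ nuC.
have fub (z : mt A H) : nu (slicer w0 z) = w0 (slicel nu z).
  apply: (bdd_tens_eq (bdd_comp W nuC) (bdd_comp S w0B)) => a b /=.
  by rewrite WE SE (bddZ nuC) (bddZ w0B) /GRing.scale /= mulrC.
rewrite (bddB S) SE fub cE (bddZ w0B) w01 /GRing.scale /= mulr1.
by rewrite -/(GRing.scale _ _) subrr.
Qed.

End FixedPoints.

(** * Finite quantum groups *)

Section FiniteDimension.
Context (R : realType) (mt : forall A B : cstarType R, minTensor A B).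

Lemma bounded_sep (A : cstarType R) (x : A) : x <> 0 ->
  exists nu : A -> R[i]^o, (exists C, bounded_by C nu) /\ nu x = 1.
Proof.
move=> x0.
(* The tensor product [mt A A] supplies a faithful representation of [A]. *)
have [E [F [G [pi [sigma [rho [tau [piP _ _ _ _]]]]]]]] := @tens_spatial _ _ _ (mt A A).
have [y y0] : exists y, pi x y <> 0.
  by apply/existsNP => H; apply: x0; exact: (rep_inj piP).
have n0 := nrm_gt0 y0.
exists (fun a => ((nrm (pi x y) ^+ 2)^-1)%:C *: (hdot E (pi a y) (pi x y) : R[i]^o));
  split.
  by eexists; exact: bdd_scale (bdd_rep y (pi x y) piP).
rewrite hdotE /GRing.scale /= -rmorphM /= mulVf //.
by rewrite sqrf_eq0 gt_eqF.
Qed.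

Lemma bdd_sum_fun (V W : normedModType R[i]) n (F : 'I_n -> V -> W) :
  (forall i, exists C, bounded_by C (F i)) ->
  exists C, bounded_by C (fun x => \sum_(i < n) F i x).
Proof.
move=> FC; have [C HC] := choice FC; exists (\sum_(i < n) C i).
split=> [c x y||x].
- rewrite scaler_sumr -big_split /=; apply: eq_bigr => i _.
  by rewrite (bddD (HC i)) (bddZ (HC i)).
- by apply: sumr_ge0 => i _; exact: bdd_ge0 (HC i).
- apply: le_trans (ler_nrm_sum _ _ _) _; rewrite mulr_suml.
  by apply: ler_sum => i _; exact: bdd_nrm.
Qed.

(* Gram-Schmidt, with a new functional for each vector outside the span. *)
Lemma biorthogonal (A : cstarType R) n (e : 'I_n -> A) :
  exists m (f : 'I_m -> A) (mu : 'I_m -> A -> R[i]^o),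
    [/\ forall i, exists C, bounded_by C (mu i),
        forall i j, mu i (f j) = (i == j)%:R &
        forall i, e i = \sum_(j < m) (mu j (e i) : R[i]) *: f j].
Proof.
elim: n e => [|n IH] e.
  by exists 0%N, (fun=> 0), (fun _ _ => 0); split=> -[].
have [m [f [mu [muB muf fe]]]] := IH (e \o lift ord0).
pose x := e ord0 - \sum_(j < m) (mu j (e ord0) : R[i]) *: f j.
have mux i : mu i x = 0.
  have [C iC] := muB i; rewrite /x (bddB iC) (bdd_sum iC) (bigD1 i) //=.
  rewrite (bddZ iC) muf eqxx big1 ?addr0 => [|j ji].
    by rewrite /GRing.scale /= mulr1 subrr.
  by rewrite (bddZ iC) muf eq_sym (negbTE ji) scaler0.
have [x0|x0] := eqVneq x 0.
  exists m, f, mu; split=> // i; case: (unliftP ord0 i) => [j ->|->]; first exact: fe.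
  by apply/eqP; rewrite -subr_eq0 -/x x0.
have [nu [[C nuC] nux]] := bounded_sep (elimN eqP x0).
pose mu0 a : R[i]^o := nu a - \sum_(j < m) (nu (f j) : R[i]) *: mu j a.
have mu0B : exists D, bounded_by D mu0.
  have [D DB] := bdd_sum_fun (fun j => let: ex_intro D jD := muB j in
    ex_intro (fun C => bounded_by C (fun a => (- (nu (f j)) : R[i]) *: mu j a)) _
      (bdd_scale (- (nu (f j) : R[i])) jD)).
  eexists; have := bdd_add nuC DB; congr bounded_by; apply/funext => a.
  by rewrite /mu0 -sumrN; congr (_ + _); apply: eq_bigr => j _; rewrite scaleNr.
have mu0f j : mu0 (f j) = 0.
  rewrite /mu0 (bigD1 j) //= muf eqxx big1 ?addr0 => [|k kj].
    by rewrite /GRing.scale /= mulr1 subrr.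
  by rewrite muf (negbTE kj) scaler0.
have mu0x : mu0 x = 1.
  by rewrite /mu0 nux big1 ?subr0 // => j _; rewrite mux scaler0.
pose f' i := oapp f x (unlift ord0 i).
pose mu' i := oapp mu mu0 (unlift ord0 i).
exists m.+1, f', mu'; split.
- by move=> i; rewrite /mu'; case: unliftP => [j _|_] /=; [exact: muB|exact: mu0B].
- move=> i j; rewrite /mu' /f'.
  case: (unliftP ord0 i) => [i' ->|->]; case: (unliftP ord0 j) => [j' ->|->] /=.
  + by rewrite muf (inj_eq lift_inj).
  + by rewrite mux.
  + by rewrite mu0f.
  + by rewrite mu0x.
- move=> i; rewrite big_ord_recl /mu' /f' unlift_none /=.
  under eq_bigr do rewrite liftK /=.
  have [D mu0D] := mu0B.
  case: (unliftP ord0 i) => [k ->|->].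
    have ek := fe k; rewrite /= in ek.
    have -> : mu0 (e (lift ord0 k)) = 0.
      rewrite ek (bdd_sum mu0D) big1 // => j _.
      by rewrite (bddZ mu0D) mu0f scaler0.
    by rewrite scale0r add0r.
  have e0E : e ord0 = x + \sum_(j < m) (mu j (e ord0) : R[i]) *: f j by rewrite subrK.
  have -> : mu0 (e ord0) = 1.
    rewrite e0E (bddD mu0D) mu0x (bdd_sum mu0D) big1 ?addr0 // => j _.
    by rewrite (bddZ mu0D) mu0f scaler0.
  by rewrite scale1r {1}e0E.
Qed.

Lemma fd_basis (K : cstarType R) : finite_dimensional K ->
  exists m (f : 'I_m -> K) (mu : 'I_m -> K -> R[i]^o),
    [/\ forall i, exists C, bounded_by C (mu i),
        forall i j, mu i (f j) = (i == j)%:R &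
        forall k, k = \sum_(j < m) (mu j k : R[i]) *: f j].
Proof.
move=> [n [e eP]]; have [m [f [mu [muB muf fe]]]] := biorthogonal e.
exists m, f, mu; split => // k; have [c ->] := eP k.
have eE j : mu j (\sum_(i < n) c i *: e i) = \sum_(i < n) c i *: mu j (e i).
  have [C jC] := muB j; rewrite (bdd_sum jC); apply: eq_bigr => i _; exact: bddZ jC _ _.
under [RHS]eq_bigr do rewrite eE scaler_suml.
rewrite exchange_big /=; apply: eq_bigr => i _; rewrite {1}fe scaler_sumr.
by apply: eq_bigr => j _; rewrite scalerA.
Qed.

End FiniteDimension.

Lemma injective_surjective_mx (F : fieldType) p q (g : 'M[F]_(p, q) -> 'M[F]_(p, q)) :
  linear g -> (forall X, g X = 0 -> X = 0) -> forall Y, exists X, g X = Y.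
Proof.
move=> glin ginj Y.
pose gL : {linear 'M[F]_(p, q) -> 'M[F]_(p, q)} :=
  HB.pack g (GRing.isLinear.Build F _ _ _ g glin).
have gU : lin_mx gL \in unitmx.
  rewrite -row_free_unit; apply: inj_row_free => v v0.
  have : g (vec_mx v) = 0.
    by apply: (can_inj mxvecK); rewrite -[g _]/(gL (vec_mx v)) -mul_vec_lin vec_mxK
      v0 linear0.
  by move=> /ginj v0'; rewrite -(vec_mxK v) v0' linear0.
exists (vec_mx (mxvec Y *m invmx (lin_mx gL))).
apply: (can_inj mxvecK).
by rewrite -[g _]/(gL _) -mul_vec_lin vec_mxK mulmxKV.
Qed.

Section FiniteDimensionalAlgebra.
Context (R : realType) (K : cstarType R) (m : nat).
Context (f : 'I_m -> K) (mu : 'I_m -> K -> R[i]^o).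
Hypothesis muB : forall i, exists C, bounded_by C (mu i).
Hypothesis muf : forall i j, mu i (f j) = (i == j)%:R.
Hypothesis fE : forall k, k = \sum_(j < m) (mu j k : R[i]) *: f j.

Let muP (r : 'I_m -> R[i]) i : mu i (\sum_(j < m) r j *: f j) = r i.
Proof.
have [C iC] := muB i; rewrite (bdd_sum iC) (bigD1 i) //= (bddZ iC) muf eqxx.
rewrite big1 ?addr0 /GRing.scale /= ?mulr1 // => j ji.
by rewrite (bddZ iC) muf eq_sym (negbTE ji) /GRing.scale /= mulr0.
Qed.

(** The algebraic form of a spectral gap at [0]. [M] is multiplication by [k] in coordinates; by the
    C*-identity [k ∙ k ∙ x = 0] implies [k ∙ x = 0], so [M] and [M *m M] have the same row space,
    which contains the coordinates of [k]. *)
Lemma selfadjoint_regular (k : K) : star k = k -> exists w, k = k ∙ k ∙ w.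
Proof.
move=> ks.
pose vec (r : 'rV[R[i]]_m) : K := \sum_(j < m) r 0 j *: f j.
pose row (x : K) : 'rV[R[i]]_m := \row_j mu j x.
have rowK x : vec (row x) = x.
  by rewrite [RHS]fE; apply: eq_bigr => j _; rewrite mxE.
have vecK r : row (vec r) = r.
  by apply/rowP => j; rewrite mxE muP.
pose M : 'M[R[i]]_m := \matrix_(i, j) mu j (k ∙ f i).
have vecM r : vec (r *m M) = k ∙ vec r.
  rewrite [RHS]fE; apply: eq_bigr => j _; congr (_ *: _).
  have [C jC] := muB j; rewrite mxE cmul_sumr (bdd_sum jC); apply: eq_bigr => i _.
  by rewrite cmulZr (bddZ jC) mxE.
have rkMM : (M <= M *m M)%MS.
  have sub : (M *m M <= M)%MS by exact: submxMl.
  rewrite -(geq_leqif (mxrank_leqif_sup sub)) -[X in (X <= _)%N](mxrank_mul_ker M M).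
  suff -> : (M :&: kermx M)%MS = 0 by rewrite mxrank0 addn0.
  apply/eqP/rowV0P => v; rewrite sub_capmx => /andP[/submxP[w ->] /sub_kermxP wMM].
  have kk0 : k ∙ (k ∙ vec w) = 0.
    by rewrite -!vecM wMM /vec big1 // => j _; rewrite mxE scale0r.
  have k0 : k ∙ vec w = 0.
    apply/nrm0_eq0/eqP; rewrite -sqrf_eq0 -nrm_starM starM ks.
    by rewrite -cmulA kk0 cmul0r nrm0.
  by rewrite -[w *m M]vecK vecM k0; apply/rowP => j; rewrite !mxE;
    have [C jC] := muB j; rewrite (bdd0 jC).
have /submxP[w wE] : (row 𝟏 *m M <= M *m M)%MS by exact: submx_trans (submxMl _ _) rkMM.
exists (vec w); rewrite -cmulA -!vecM -mulmxA -wE vecM rowK cmul1r //.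
Qed.

(** Multiplying rows over [K] on the right by [u] is an injective linear map of a finite-dimensional
    space, hence surjective; the rows of [v] are preimages of the unit rows. In coordinates a row is
    a square matrix, since [m] is both its length and the dimension of [K]. *)
Lemma injective_left_inverse (u : 'I_m -> 'I_m -> K) :
  (forall x : 'I_m -> K, (forall i, \sum_(a < m) x a ∙ u a i = 0) -> forall a, x a = 0) ->
  exists v : 'I_m -> 'I_m -> K,
    forall a b, \sum_(i < m) v a i ∙ u i b = (a == b)%:R *: 𝟏.
Proof.
move=> uinj.
pose dec (X : 'M[R[i]]_m) a : K := \sum_(c < m) X a c *: f c.
pose g (X : 'M[R[i]]_m) : 'M[R[i]]_m := \matrix_(i, c) mu c (\sum_(a < m) dec X a ∙ u
  a i).
have decK (x : 'I_m -> K) a : dec (\matrix_(a, c) mu c (x a)) a = x a.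
  by rewrite [RHS]fE; apply: eq_bigr => c _; rewrite mxE.
have glin : linear g.
  move=> c X Y; apply/matrixP => i d; rewrite !mxE.
  have [C dC] := muB d; rewrite -[c * _]/(c *: mu d _) -(bddZ dC) -(bddD dC).
  congr mu; rewrite scaler_sumr -big_split /=; apply: eq_bigr => a _.
  rewrite -cmulZl -cmulDl; congr (_ ∙ _).
  rewrite /dec scaler_sumr -big_split /=; apply: eq_bigr => e _.
  by rewrite !mxE scalerDl scalerA.
have gdec X i : \sum_(a < m) dec X a ∙ u a i = \sum_(c < m) g X i c *: f c.
  by rewrite [LHS]fE; apply: eq_bigr => c _; rewrite mxE.
have ginj X : g X = 0 -> X = 0.
  move=> gX0; apply/matrixP => a c; rewrite mxE.
  have : dec X a = 0.
    by apply: (uinj (dec X)) => i; rewrite gdec gX0 big1 // => j _; rewrite mxE scale0r.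
  by move=> dX; have := muP (X a) c; rewrite -/(dec X a) dX; have [C cC] := muB c;
    rewrite (bdd0 cC).
have vex (a : 'I_m) : exists v : 'I_m -> K,
    forall b, \sum_(i < m) v i ∙ u i b = (a == b)%:R *: 𝟏.
  have [X gX] := injective_surjective_mx glin ginj (\matrix_(b, c) mu c ((a == b)%:R
    *: 𝟏)).
  exists (dec X) => b; rewrite gdec gX [RHS]fE; apply: eq_bigr => c _; by rewrite mxE.
by have [v vE] := choice vex; exists v.
Qed.

End FiniteDimensionalAlgebra.

Section Composition.
Context (R : realType) (A B C : cstarType R).
Context (g : {starmorphism B -> C}) (f : {starmorphism A -> B}).

Fact comp_starM x y : (g \o f) (x ∙ y) = (g \o f) x ∙ (g \o f) y.
Proof. by rewrite /= !star_morphM. Qed.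
Fact comp_star1 : (g \o f) 𝟏 = 𝟏.
Proof. by rewrite /= !star_morph1. Qed.
Fact comp_star_star x : (g \o f) (star x) = star ((g \o f) x).
Proof. by rewrite /= !star_morph_star. Qed.
HB.instance Definition _ := isStarMorphism.Build R A C (g \o f)
  comp_starM comp_star1 comp_star_star.

End Composition.

Section Identity.
Context (R : realType) (A : cstarType R).

Fact id_starM (x y : A) : idfun (x ∙ y) = idfun x ∙ idfun y. Proof. by []. Qed.
Fact id_star1 : idfun (𝟏 : A) = 𝟏. Proof. by []. Qed.
Fact id_star_star (x : A) : idfun (star x) = star (idfun x). Proof. by []. Qed.
HB.instance Definition _ := isStarMorphism.Build R A A idfun
  id_starM id_star1 id_star_star.

End Identity.

Section FiniteQuantumGroup.
Context (R : realType) (mt : forall A B : cstarType R, minTensor A B).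
Context (K : cstarType R) (Delta : {starmorphism K -> mt K K}).
Hypothesis KP : compact_quantum_group Delta.
Context (m : nat) (f : 'I_m -> K) (mu : 'I_m -> K -> R[i]^o).
Hypothesis muB : forall i, exists C, bounded_by C (mu i).
Hypothesis muf : forall i j, mu i (f j) = (i == j)%:R.
Hypothesis fE : forall k, k = \sum_(j < m) (mu j k : R[i]) *: f j.

(* [Delta k] is the sum of the [f a \ox leg2 a k]. *)
Definition leg2 (a : 'I_m) (k : K) : K := slicel (mu a) (Delta k).

Lemma slicel_mu a : exists C, bounded_by C (slicel (T := mt K K) (mu a)) /\
  forall k l, slicel (T := mt K K) (mu a) (k \ox l) = (mu a k : R[i]) *: l.
Proof.
by have [C aC] := muB a; have [S SE] := slicelP (mt K K) aC; exists C.
Qed.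

Lemma tensor_coord (B : cstarType R) (z : mt K B) :
  z = \sum_(a < m) f a \ox slicel (mu a) z.
Proof.
have [C SB] : exists C, bounded_by C (fun z : mt K B => \sum_(a < m) f a \ox slicel
  (mu a) z : mt K B).
  apply: bdd_sum_fun => a; have [C aC] := muB a; have [S SE] := slicelP (mt K B) aC.
  exists (nrm (f a) * C); split=> [c x y||x].
  - by rewrite (bddD S) (bddZ S) linearPr.
  - by rewrite mulr_ge0 ?nrm_ge0 ?(bdd_ge0 aC).
  - apply: le_trans (nrm_tens _ _ _) _; rewrite -mulrA ler_wpM2l ?nrm_ge0 //;
      exact: bdd_nrm.
move: z; apply: (bdd_tens_eq (bdd_id _) SB) => k b.
rewrite {1}(fE k) linear_sumlz; apply: eq_bigr => a _.
have [D aD] := muB a; have [_ ->] := slicelP (mt K B) aD.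
by rewrite linearZl_LR linearZr_LR.
Qed.

Lemma leg2E k : Delta k = \sum_(a < m) f a \ox leg2 a k.
Proof. exact: tensor_coord. Qed.

Lemma bdd_leg2 a : exists C, bounded_by C (leg2 a).
Proof.
have [C [S _]] := slicel_mu a; exists (C * 1).
exact: bdd_comp (bdd_starmorph Delta) S.
Qed.

Lemma leg2_lin a k : leg2 a k = \sum_(b < m) (mu b k : R[i]) *: leg2 a (f b).
Proof.
have [C aC] := bdd_leg2 a; rewrite {1}(fE k) (bdd_sum aC).
by apply: eq_bigr => b _; exact: bddZ aC _ _.
Qed.

(** Coassociativity at [k], with [mu a] applied to the first factor: the [leg2 a (f b)] are the
    matrix coefficients of the regular corepresentation. *)
Lemma leg2_coass a k : Delta (leg2 a k) = \sum_(b < m) leg2 a (f b) \ox leg2 b k.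
Proof.
have [_ [F [G [alpha [FE GE alphaE co]]]] _ _] := KP.
have [C aC] := muB a; have [S SE] := slicelP (mt K (mt K K)) aC.
have [S' SE'] := slicelP (mt K K) aC.
have h1 : slicel (mu a) (G (Delta k)) = Delta (leg2 a k).
  rewrite {1}(leg2E k) (bdd_sum (bdd_starmorph G)) (bdd_sum S).
  rewrite {2}/leg2 [in RHS](leg2E k) (bdd_sum S') (bdd_sum (bdd_starmorph Delta)).
  apply: eq_bigr => b _.
  by rewrite GE SE SE' (bddZ (bdd_starmorph Delta)).
rewrite -h1 -co {1}(leg2E k) (bdd_sum (bdd_starmorph F)) (bdd_sum (bdd_starmorph alpha)).
rewrite (bdd_sum S); apply: eq_bigr => b _.
rewrite FE {1}(leg2E (f b)) linear_sumlz (bdd_sum (bdd_starmorph alpha)) (bdd_sum S).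
have -> : leg2 a (f b) = \sum_(c < m) (mu a (f c) : R[i]) *: leg2 c (f b).
  by rewrite {1}/leg2 leg2E (bdd_sum S'); apply: eq_bigr => c _; rewrite SE'.
by rewrite linear_sumlz; apply: eq_bigr => c _; rewrite alphaE SE linearZl_LR.
Qed.

Lemma Delta_left_dense :
  dense (lin_span [set x : mt K K | exists h k, x = Delta k ∙ (𝟏 \ox h)]).
Proof.
have [_ _ _ dens] := KP; apply: nrm_dense => x e e0.
have [y [n [c [s [Ss yE]]]] xy] := dense_nrm dens (star x) e0.
exists (star y); last by rewrite -{1}(starK x) -starB nrm_star.
exists n, (fun i => Num.conj (c i)), (fun i => star (s i)); split.
  move=> i; have [h [k ->]] := Ss i; exists (star h), (star k).
  by rewrite starM tens_star star1 star_morph_star.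
by rewrite yE star_sum; apply: eq_bigr => i _; rewrite starZ.
Qed.

Section Cancellation.
Context (B : cstarType R) (j : {starmorphism K -> B}).

(** When [mu] is dual to [f], this is the linear map with [f a \ox l] sent to [x a ∙ j l]; its
    values on [Delta k] are the sums to be solved for [x]. *)
Definition pairing (x : 'I_m -> B) (z : mt K K) : B :=
  \sum_(a < m) x a ∙ j (slicel (mu a) z).

Lemma bdd_pairing x : exists C, bounded_by C (pairing x).
Proof.
apply: bdd_sum_fun => a; have [C [S _]] := slicel_mu a.
eexists; exact: bdd_comp (bdd_comp S (bdd_starmorph j)) (bdd_cmull (x a)).
Qed.

Lemma pairing_Delta x k : pairing x (Delta k) = \sum_(a < m) x a ∙ j (leg2 a k).
Proof. by []. Qed.

Lemma pairing_tens x k l :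
  pairing x (k \ox l) = (\sum_(a < m) (mu a k : R[i]) *: x a) ∙ j l.
Proof.
rewrite cmul_suml; apply: eq_bigr => a _; have [C [_ ->]] := slicel_mu a.
by rewrite linearZ cmulZr cmulZl.
Qed.

Lemma pairing_f x a l : pairing x (f a \ox l) = x a ∙ j l.
Proof.
rewrite pairing_tens; congr (_ ∙ _); rewrite (bigD1 a) //= muf eqxx scale1r.
by rewrite big1 ?addr0 // => b ba; rewrite muf (negbTE ba) scale0r.
Qed.

Lemma slicel_mulr (nu : K -> R[i]^o) C (z : mt K K) (l : K) : bounded_by C nu ->
  slicel nu (z ∙ (𝟏 \ox l)) = slicel nu z ∙ l.
Proof.
move=> nuC; have [S SE] := slicelP (mt K K) nuC.
move: z; apply: (bdd_tens_eq (bdd_comp (bdd_cmulr _) S) (bdd_comp S (bdd_cmulr l)))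
  => k k' /=.
by rewrite tensM cmul1r !SE cmulZl.
Qed.

Lemma slicel_mull (nu : K -> R[i]^o) C (z : mt K K) (l : K) : bounded_by C nu ->
  slicel nu ((𝟏 \ox l) ∙ z) = l ∙ slicel nu z.
Proof.
move=> nuC; have [S SE] := slicelP (mt K K) nuC.
move: z; apply: (bdd_tens_eq (bdd_comp (bdd_cmull _) S) (bdd_comp S (bdd_cmull l)))
  => k k' /=.
by rewrite tensM cmul1l !SE cmulZr.
Qed.

Lemma pairing_mulr x z l : pairing x (z ∙ (𝟏 \ox l)) = pairing x z ∙ j l.
Proof.
rewrite /pairing cmul_suml; apply: eq_bigr => a _; have [C aC] := muB a.
by rewrite (slicel_mulr _ _ aC) star_morphM cmulA.
Qed.

Lemma pairing_mull x z l : (forall a k, x a ∙ j k = j k ∙ x a) ->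
  pairing x ((𝟏 \ox l) ∙ z) = j l ∙ pairing x z.
Proof.
move=> xj; rewrite /pairing cmul_sumr; apply: eq_bigr => a _; have [C aC] := muB a.
by rewrite (slicel_mull _ _ aC) star_morphM !cmulA xj.
Qed.

(** The pairing vanishes on all [Delta k ∙ (𝟏 \ox h)], which span a dense subspace, hence on
    [f a \ox 𝟏], where its value is [x a]. *)
Lemma leg2_cancel (x : 'I_m -> B) :
  (forall k, \sum_(a < m) x a ∙ j (leg2 a k) = 0) -> forall a, x a = 0.
Proof.
move=> x0 a; have [C xC] := bdd_pairing x.
rewrite -(cmul1r (x a)) -(star_morph1 (s := j)) -pairing_f.
have z0 : bounded_by 0 (fun _ : mt K K => 0 : B).
  by split=> [c u v||u]; rewrite ?scaler0 ?addr0 ?nrm0 ?mul0r.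
rewrite (bdd_dense Delta_left_dense xC z0) // => _ [h [k ->]].
by rewrite pairing_mulr pairing_Delta x0 cmul0l.
Qed.

End Cancellation.

Lemma leg2_eq (B : cstarType R) (j : {starmorphism K -> B}) (x y : 'I_m -> B) :
  (forall k, \sum_(a < m) x a ∙ j (leg2 a k) = \sum_(a < m) y a ∙ j (leg2 a k)) ->
  forall a, x a = y a.
Proof.
move=> xy a; apply/eqP; rewrite -subr_eq0; apply/eqP.
apply: (leg2_cancel (j := j) (x := fun a => x a - y a)) => k.
under eq_bigr do rewrite cmulBl.
by rewrite sumrB xy subrr.
Qed.

(** [v] is a left inverse of the matrix [leg2 i (f b)]. It is chosen before [B], [j] and [phi], so
    one choice serves the whole path of morphisms. *)
Lemma leg2_inverse : exists v : 'I_m -> 'I_m -> K,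
  forall (B : cstarType R) (j phi : {starmorphism K -> B}) k,
    phi k = \sum_(i < m) (\sum_(a < m) phi (f a) ∙ j (v a i)) ∙ j (leg2 i k).
Proof.
have [|v vE] := injective_left_inverse muB muf fE (u := fun a i => leg2 a (f i)).
  move=> x x0; apply: (leg2_cancel (j := idfun)) => k /=.
  under eq_bigr do rewrite leg2_lin cmul_sumr.
  rewrite exchange_big big1 // => b _ /=.
  under eq_bigr do rewrite cmulZr.
  by rewrite -scaler_sumr x0 scaler0.
exists v => B j phi k.
under eq_bigr do rewrite leg2_lin (bdd_sum (bdd_starmorph j)) cmul_sumr.
rewrite exchange_big {1}(fE k) (bdd_sum (bdd_starmorph phi)) /=; apply: eq_bigr => b _.
under eq_bigr do rewrite (bddZ (bdd_starmorph j)) cmulZr.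
rewrite -scaler_sumr (bddZ (bdd_starmorph phi)); congr (_ *: _).
under eq_bigr do rewrite cmul_suml.
rewrite exchange_big /=.
under eq_bigr => a _.
  under eq_bigr do rewrite -cmulA -star_morphM.
  rewrite -cmul_sumr -(bdd_sum (bdd_starmorph j)) vE (bddZ (bdd_starmorph j))
    star_morph1 cmulZr cmul1r.
  over.
by rewrite (bigD1 b) //= eqxx scale1r big1 ?addr0 // => a ab; rewrite (negbTE ab) scale0r.
Qed.

End FiniteQuantumGroup.

Section LegMorphism.
Context (R : realType) (mt : forall A B : cstarType R, minTensor A B).
Context (K : cstarType R) (Delta : {starmorphism K -> mt K K}).
Hypothesis KP : compact_quantum_group Delta.
Context (m : nat) (f : 'I_m -> K) (mu : 'I_m -> K -> R[i]^o).
Hypothesis muB : forall i, exists C, bounded_by C (mu i).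
Context (B : cstarType R) (j phi : {starmorphism K -> B}) (psi : 'I_m -> B).
Hypothesis phiE : forall k, phi k = \sum_(a < m) psi a ∙ j (leg2 Delta mu a k).
Hypothesis psi_comm : forall a k, psi a ∙ j k = j k ∙ psi a.

(* [Theta] is multiplicative because it is on products of an [(1 \ox h) Delta k]
   with a [Delta l (1 \ox c)], and both families span densely. *)
Let Theta := @pairing R mt K m mu B j psi.

Let Theta_Delta k : Theta (Delta k) = phi k.
Proof. by rewrite phiE. Qed.

Let ThetaM x y : Theta (x ∙ y) = Theta x ∙ Theta y.
Proof.
have [C TB] := bdd_pairing mt muB j psi; rewrite -/Theta in TB.
have [_ _ _ dens] := KP.
move: y; apply: (bdd_dense (Delta_left_dense KP) (bdd_comp (bdd_cmull x) TB)
  (bdd_comp TB (bdd_cmull (Theta x)))).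
move=> _ [c [l ->]] /=; move: x.
apply: (bdd_dense dens (bdd_comp (bdd_cmulr _) TB) (bdd_comp TB (bdd_cmulr _))).
move=> _ [h [k ->]] /=.
rewrite -cmulA {1}/Theta (pairing_mull muB) // cmulA -star_morphM.
rewrite /Theta (pairing_mulr muB) (pairing_mulr muB) (pairing_mull muB) // -/Theta.
by rewrite !Theta_Delta star_morphM !cmulA.
Qed.

Let Theta_star x : Theta (star x) = star (Theta x).
Proof.
have [C TB] := bdd_pairing mt muB j psi; rewrite -/Theta in TB.
have [_ _ _ dens] := KP.
apply: star_inj; rewrite starK; move: x.
apply: (bdd_dense dens (bdd_starconj TB) TB) => _ [h [k ->]].
rewrite starM tens_star star1 -star_morph_star /Theta (pairing_mulr muB)
  (pairing_mull muB) // -/Theta.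
by rewrite !Theta_Delta starM !star_morph_star !starK.
Qed.

(** The [Psi] of the overview; it is [Theta] on [K (x) 1] and inherits its multiplicativity. *)
Definition leg_morph (k : K) : B := \sum_(a < m) (mu a k : R[i]) *: psi a.

Let leg_morphE k : leg_morph k = Theta (k \ox 𝟏).
Proof. by rewrite /Theta (pairing_tens mt muB) star_morph1 cmul1r. Qed.

Lemma leg_morphM k l : leg_morph (k ∙ l) = leg_morph k ∙ leg_morph l.
Proof. by rewrite !leg_morphE -ThetaM tensM cmul1l. Qed.

Lemma leg_morph_star k : leg_morph (star k) = star (leg_morph k).
Proof. by rewrite !leg_morphE -Theta_star tens_star star1. Qed.

Lemma leg_morph1 : leg_morph 𝟏 = 𝟏.
Proof. by rewrite leg_morphE tens11 -(star_morph1 (s := Delta)) Theta_Delta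
  star_morph1. Qed.

End LegMorphism.

(** * Paths in the join *)

(** The inequality excludes values strictly between [0] and [1/C]. If [g 1] were positive, [g] would
    take the excluded value [v]; the factor [2] in [v] keeps it strictly below [1/C]. *)
Lemma norm_gap (R : realType) (g : R -> R) (C : R) :
  {within `[0, 1], continuous g} -> g 0 = 0 ->
  {in `[0, 1], forall t, 0 <= g t <= C * g t ^+ 2} -> g 1 = 0.
Proof.
move=> gc g0 gC.
have i1 : (1 : R) \in `[0, 1] by rewrite in_itv /= ler01 lexx.
apply/eqP; rewrite eq_le; have /andP[g1 _] := gC _ i1; rewrite g1 andbT leNgt.
apply/negP => g1p.
have C0 : 0 < C.
  have /andP[_ h] := gC _ i1; rewrite ltNge; apply/negP => C0; nra.
pose v := Num.min (g 1) (2 * C)^-1.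
have v0 : 0 < v by rewrite lt_min g1p invr_gt0 mulr_gt0.
have [|t t01 gt] := @IVT _ g 0 1 v ler01 gc.
  by rewrite g0 minEle g1 maxEle g1 ltW //= ge_min lexx.
have /andP[_ h] := gC t t01; rewrite gt in h.
have h2 : v * (2 * C) <= 1.
  by rewrite -ler_pdivlMr ?mulr_gt0 // mul1r ge_min lexx orbT.
nra.
Qed.

Lemma continuous_nrm_sum (R : realType) (A : cstarType R) n (F : 'I_n -> R -> A)
    (b : 'I_n -> A) (S : set R) :
  (forall a, {within S, continuous (F a)}) ->
  {within S, continuous (fun t => nrm (\sum_(a < n) F a t ∙ b a))}.
Proof.
move=> Fc; apply/subspace_continuousP => t St; apply/cvgrPdist_lt => e e0.
set M := \sum_(a < n) nrm (b a).
have M0 : 0 <= M by apply: sumr_ge0 => a _; exact: nrm_ge0.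
have M1 : 0 < M + 1 by lra.
have dC : 0 < (e / (M + 1))%:C by rewrite ltcR divr_gt0.
have : \forall s \near within S (nbhs t), forall a, `|F a t - F a s| < (e / (M + 1))%:C.
  apply: filter_forall => a.
  by have /subspace_continuousP/(_ t St)/cvgrPdist_lt/(_ _ dC) := Fc a.
apply: filterS => s Hs /=.
have -> : e = (e / (M + 1)) * (M + 1) by rewrite divfK // lt0r_neq0.
set u := \sum_(a < n) F a t ∙ b a; set w := \sum_(a < n) F a s ∙ b a.
have : `|nrm u - nrm w| <= nrm (u - w).
  rewrite ler_norml; apply/andP; split.
    by have := ler_nrmD (w - u) u; rewrite subrK (nrmBC w); lra.
  by have := ler_nrmD (u - w) w; rewrite subrK; lra.
move/le_lt_trans; apply; rewrite /u /w -sumrB.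
apply: le_lt_trans (ler_nrm_sum _ _ _) _.
apply: (@le_lt_trans _ _ ((e / (M + 1)) * M)).
  rewrite mulr_sumr; apply: ler_sum => a _; rewrite -cmulBl.
  apply: le_trans (ler_nrmM _ _) _; rewrite ler_wpM2r ?nrm_ge0 //.
  by have := Hs a; rewrite nrmE ltcR => /ltW.
by rewrite ltr_pM2l ?divr_gt0 // ltrDl.
Qed.

Section Slicing.
Context (R : realType) (A B : cstarType R) (T : minTensor A B).
Context (nu : A -> R[i]^o) (C : R).
Hypotheses (nuC : bounded_by C nu) (nu1 : nu 𝟏 = 1).

Lemma legr_inj : injective (legr T).
Proof.
move=> x y xy; have [_ SE] := slicelP T nuC.
by have := congr1 (slicel nu) xy; rewrite /legr !SE nu1 !scale1r.
Qed.

Lemma legr_legl_scalar b a : legr T b = legl T a -> legr T b = (nu a : R[i]) *: 𝟏.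
Proof.
move=> ba; have [_ SE] := slicelP T nuC.
have bE : b = (nu a : R[i]) *: 𝟏.
  by have := congr1 (slicel nu) ba; rewrite /legr /legl !SE nu1 scale1r.
by rewrite {1}bE linearZ /= star_morph1.
Qed.

End Slicing.

Lemma legl_inj (R : realType) (A B : cstarType R) (T : minTensor A B)
    (nu : B -> R[i]^o) C : bounded_by C nu -> nu 𝟏 = 1 -> injective (legl T).
Proof.
move=> nuC nu1 x y xy; have [_ SE] := slicerP T nuC.
by have := congr1 (slicer nu) xy; rewrite /legl !SE nu1 !scale1r.
Qed.

(** * Coefficients of an equivariant map on the finite quantum subgroup *)

Section QuantumSubgroup.
Context (R : realType) (mt : forall A B : cstarType R, minTensor A B).
Context (A H K : cstarType R) (DeltaH : {starmorphism H -> mt H H})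
  (DeltaK : {starmorphism K -> mt K K}) (iota : {starmorphism K -> H}).
Hypotheses (HP : compact_quantum_group DeltaH) (KP : compact_quantum_group DeltaK).
Hypothesis iotaP : quantum_group_embedding DeltaK DeltaH iota.
Context (m : nat) (f : 'I_m -> K) (mu : 'I_m -> K -> R[i]^o).
Hypothesis muB : forall i, exists C, bounded_by C (mu i).
Hypothesis muf : forall i j, mu i (f j) = (i == j)%:R.
Hypothesis fE : forall k, k = \sum_(j < m) (mu j k : R[i]) *: f j.
Local Notation leg := (leg2 DeltaK mu).

Lemma Delta_iota k : DeltaH (iota k) = \sum_(a < m) iota (f a) \ox iota (leg a k).
Proof.
have [_ [F FE ->]] := iotaP; rewrite (leg2E DeltaK muB fE) (bdd_sum (bdd_starmorph F)).
by apply: eq_bigr => a _; rewrite FE.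
Qed.

Lemma Delta_iota_leg a k :
  DeltaH (iota (leg a k)) = \sum_(b < m) iota (leg a (f b)) \ox iota (leg b k).
Proof.
have [_ [F FE ->]] := iotaP; rewrite (leg2_coass KP muB fE) (bdd_sum (bdd_starmorph F)).
by apply: eq_bigr => b _; rewrite FE.
Qed.

Definition leg_iota (B : cstarType R) : {starmorphism K -> mt B H} :=
  legr (mt B H) \o iota.

Lemma leg_iotaE B k : leg_iota B k = 𝟏 \ox iota k.
Proof. by []. Qed.

(* Coassociativity makes [psi a] a fixed point of [id (x) Delta], and these are
   the elements of [A (x) 1]. *)
Lemma leg_scalar (phi : {starmorphism K -> mt A H}) (psi : 'I_m -> mt A H)
    (G : {starmorphism mt A H -> mt A (mt H H)})
    (alpha : {starmorphism mt (mt A H) H -> mt A (mt H H)}) :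
  is_tensor_map id DeltaH G -> is_associator alpha ->
  (forall k, G (phi k) = alpha (\sum_(a < m) phi (f a) \ox iota (leg a k))) ->
  (forall k, phi k = \sum_(a < m) psi a ∙ leg_iota A (leg a k)) ->
  forall a, exists y, psi a = legl (mt A H) y.
Proof.
move=> GE alphaE Gphi phiE a; apply: (fixed_leg HP GE alphaE).
(* In [A (x) H (x) H], [I] is [x |-> x (x) 1], while [j2] and [j3] place [iota k] in the second and
   third factor. Expanding [G (phi l)] in two ways allows [j3] to be cancelled first ([coef]) and
   then [j2]. *)
pose I : {starmorphism mt A H -> mt A (mt H H)} := alpha \o legl (mt (mt A H) H).
pose j3 : {starmorphism K -> mt A (mt H H)} := alpha \o (legr (mt (mt A H) H) \o iota).
pose j2 : {starmorphism K -> mt A (mt H H)} := I \o leg_iota A.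
have j3E k : j3 k = alpha (legr (mt (mt A H) H) (iota k)) by [].
have j2E k : j2 k = I (leg_iota A k) by [].
have split (x : mt A H) h : alpha (x \ox h) = I x ∙ alpha (legr (mt (mt A H) H) h).
  by rewrite -[I x]/(alpha (legl _ x)) -(star_morphM (s := alpha)) /legl /legr tensM
    cmul1l cmul1r.
suff : G (psi a) = I (psi a) by [].
move: a; apply: (leg2_eq KP muB muf (j := j2)) => k.
have Gj2 l i : G (leg_iota A (leg i l)) = \sum_(b < m) j2 (leg i (f b)) ∙ j3 (leg b l).
  rewrite leg_iotaE GE Delta_iota_leg linear_sumr; apply: eq_bigr => b _.
  by rewrite j3E j2E leg_iotaE -split alphaE.
have coef b : \sum_(i < m) G (psi i) ∙ j2 (leg i (f b)) =
              \sum_(i < m) I (psi i) ∙ j2 (leg i (f b)).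
  move: b; apply: (leg2_eq KP muB muf (j := j3)) => l.
  transitivity (G (phi l)).
    rewrite phiE (bdd_sum (bdd_starmorph G)).
    under eq_bigr do rewrite cmul_suml.
    rewrite exchange_big /=; apply: eq_bigr => i _.
    rewrite (star_morphM (s := G)) Gj2 cmul_sumr; apply: eq_bigr => b _; by rewrite cmulA.
  rewrite Gphi (bdd_sum (bdd_starmorph alpha)); apply: eq_bigr => b _.
  rewrite split phiE (bdd_sum (bdd_starmorph I)); congr (_ ∙ _).
  by apply: eq_bigr => i _; rewrite (star_morphM (s := I)).
under eq_bigr do rewrite (leg2_lin _ muB fE) (bdd_sum (bdd_starmorph j2)) cmul_sumr.
under [RHS]eq_bigr do rewrite (leg2_lin _ muB fE) (bdd_sum (bdd_starmorph j2)) cmul_sumr.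
rewrite exchange_big [RHS]exchange_big; apply: eq_bigr => b _.
under eq_bigr do rewrite (bddZ (bdd_starmorph j2)) cmulZr.
under [RHS]eq_bigr do rewrite (bddZ (bdd_starmorph j2)) cmulZr.
by rewrite -!scaler_sumr coef.
Qed.

End QuantumSubgroup.

(** On [(a \ox 𝟏) ∙ Delta b] the slice by [chi] is the scalar [chi a * chi b]. By density all slices
    by [chi] are scalar, in particular that of [𝟏 \ox k], which is [k]. *)
Lemma invariant_character_trivial (R : realType)
    (mt : forall A B : cstarType R, minTensor A B) (K : cstarType R)
    (Delta : {starmorphism K -> mt K K}) (chi : K -> R[i]^o) C :
  compact_quantum_group Delta -> bounded_by C chi -> chi 𝟏 = 1 ->
  (forall k l, chi (k ∙ l) = (chi k : R[i]) * (chi l : R[i]) :> R[i]) ->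
  (forall k, slicel chi (Delta k) = (chi k : R[i]) *: 𝟏) -> ~ nontrivial K.
Proof.
move=> [_ _ dens _] chiC chi1 chiM chiD; apply.
have [S SE] := slicelP (mt K K) chiC.
have scal (b : K) : exists D, bounded_by D (fun z : mt K K => (chi (slicel chi z) :
  R[i]) *: b).
  exists (C * C * nrm b); split=> [c x y||x].
  - by rewrite (bddD S) (bddZ S) (bddD chiC) (bddZ chiC) scalerDl scalerA.
  - by rewrite !mulr_ge0 ?nrm_ge0 ?(bdd_ge0 chiC).
  - rewrite nrmZ mulrAC ler_wpM2r ?nrm_ge0 //.
    by have := bdd_nrm (bdd_comp S chiC) x.
have kE k : k = (chi k : R[i]) *: 𝟏.
  have [D scalD] := scal 𝟏.
  have := bdd_dense dens S scalD; move=> /(_ _ (𝟏 \ox k)).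
  rewrite SE chi1 scale1r; apply => _ [a [b ->]].
  have -> : slicel chi ((a \ox 𝟏) ∙ Delta b) = (chi a : R[i]) *: slicel chi (Delta b).
    move: (Delta b) => z; move: z.
    apply: (bdd_tens_eq (bdd_comp (bdd_cmull _) S) (bdd_scale (chi a) S)) => k' l' /=.
    by rewrite tensM cmul1l !SE chiM scalerA.
  by rewrite chiD scalerA (bddZ chiC) chi1 /GRing.scale /= mulr1.
exists chi => [c|k]; last by rewrite -kE.
by rewrite (bddZ chiC) chi1 /GRing.scale /= mulr1.
Qed.

Lemma spanned_selfadjoint (R : realType) (K B : cstarType R) (p q : K -> B) :
  (forall c x y, p (c *: x + y) = c *: p x + p y) ->
  (forall c x y, q (c *: x + y) = c *: q x + q y) ->
  (forall k, star k = k -> p k = q k) -> forall k, p k = q k.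
Proof.
move=> pl ql pq k.
pose x := (2^-1 : R)%:C *: (k + star k); pose y := ('i * (2^-1 : R)%:C) *: (star k - k).
have xs : star x = x by rewrite /x starZR starD starK addrC.
have ys : star y = y.
  rewrite /y starZ starB starK rmorphM /= [Num.conj (_%:C)]conj_Creal ?complex_real //.
  have -> : Num.conj ('i : R[i]) = - 'i by exact: conjCi.
  by rewrite mulNr scaleNr -scalerN opprB.
have kE : k = 'i *: y + x.
  rewrite /x /y scalerA mulrA -expr2 sqr_i mulN1r scaleNr -scalerN opprB -scalerDr.
  by rewrite addrACA addNr addr0 halfZ.
by rewrite kE pl ql !pq.
Qed.

(** * Paths of *-homomorphisms that start at a character *)

Section Path.
Context (R : realType) (K B : cstarType R) (m : nat).
Context (mu : 'I_m -> K -> R[i]^o) (psi : R -> 'I_m -> B) (c : 'I_m -> R[i]).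
Hypothesis muB : forall i, exists C, bounded_by C (mu i).
Local Notation Psi t := (leg_morph mu (psi t)).
Hypothesis PsiM : {in `[0, 1], forall t k l, Psi t (k ∙ l) = Psi t k ∙ Psi t l}.
Hypothesis Psi_star : {in `[0, 1], forall t k, Psi t (star k) = star (Psi t k)}.
Hypothesis Psi1 : {in `[0, 1], forall t, Psi t 𝟏 = 𝟏}.
Hypothesis Psi_cont : forall k, {within `[0, 1], continuous (fun t => nrm (Psi t k))}.
Hypothesis psi_bound : exists M : R, {in `[0, 1], forall t i, nrm (psi t i) <= M}.
Hypothesis B1 : (𝟏 : B) <> 0.
Hypothesis psi0 : forall i, psi 0 i = c i *: 𝟏.
Hypothesis regular : forall k : K, star k = k -> exists w, k = k ∙ k ∙ w.

Definition start_character (k : K) : R[i]^o := \sum_(a < m) (c a : R[i]) *: mu a k.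
Local Notation chi := start_character.

Let in0 : (0 : R) \in `[0, 1]. Proof. by rewrite in_itv /= lexx ler01. Qed.
Let in1 : (1 : R) \in `[0, 1]. Proof. by rewrite in_itv /= ler01 lexx. Qed.

Lemma bdd_start_character : exists C, bounded_by C chi.
Proof.
apply: bdd_sum_fun => a; have [C aC] := muB a.
by exists (nrm (c a : R[i]^o) * C); have := bdd_scale (c a) aC.
Qed.

Lemma leg_morph_start k : Psi 0 k = (chi k : R[i]) *: 𝟏.
Proof.
rewrite /leg_morph /chi scaler_suml; apply: eq_bigr => a _.
by rewrite psi0 scalerA mulrC.
Qed.

Let scal1_inj (a b : R[i]) : a *: (𝟏 : B) = b *: 𝟏 -> a = b.
Proof.
move=> /eqP; rewrite -subr_eq0 -scalerBl scaler_eq0 subr_eq0 => /orP[/eqP //|/eqP].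
by move/B1.
Qed.

Lemma start_characterM k l : chi (k ∙ l) = (chi k : R[i]) * (chi l : R[i]) :> R[i].
Proof.
apply: scal1_inj; rewrite -leg_morph_start PsiM // !leg_morph_start.
by rewrite cmulZl cmulZr cmul1l scalerA.
Qed.

Lemma start_character1 : chi 𝟏 = 1.
Proof. by apply: scal1_inj; rewrite -leg_morph_start Psi1 // scale1r. Qed.

Lemma bdd_leg_morph t : exists C, bounded_by C (Psi t).
Proof.
apply: bdd_sum_fun => a; have [C aC] := muB a.
exists (C * nrm (psi t a)); split=> [d x y||x].
- by rewrite (bddD aC) (bddZ aC) scalerDl scalerA.
- by rewrite mulr_ge0 ?nrm_ge0 ?(bdd_ge0 aC).
- by rewrite nrmZ mulrAC ler_wpM2r ?nrm_ge0 //; exact: bdd_nrm aC x.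
Qed.

(* With [k0 = k - chi k] and [k0 = k0^2 w], the norm [g t] of [Psi t k0]
   satisfies [g <= C g^2], so it cannot leave the value [g 0 = 0]. *)
Lemma leg_morph_end k : Psi 1 k = (chi k : R[i]) *: 𝟏.
Proof.
have [C chiC] := bdd_start_character; have [D PsiD] := bdd_leg_morph 1.
move: k; apply: spanned_selfadjoint => [d x y|d x y|k ks].
- by rewrite (bddD PsiD) (bddZ PsiD).
- by rewrite (bddD chiC) (bddZ chiC) scalerDl scalerA.
have chi_real : Num.conj (chi k : R[i]) = chi k.
  apply: scal1_inj; rewrite -leg_morph_start -{2}ks Psi_star // leg_morph_start.
  by rewrite starZ star1.
pose k0 := k - (chi k : R[i]) *: 𝟏.
have k0s : star k0 = k0 by rewrite /k0 starB starZ star1 ks chi_real.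
have [w wE] := regular k0s.
have [M psiM] := psi_bound.
(* The constant of the gap inequality: a bound on [Psi t w] uniform in [t]. *)
pose N := \sum_(a < m) nrm (mu a w) * M.
have PsiN : {in `[0, 1], forall t, nrm (Psi t w) <= N}.
  move=> t t01; apply: le_trans (ler_nrm_sum _ _ _) _; apply: ler_sum => a _.
  by rewrite nrmZ ler_wpM2l ?psiM //; exact: nrm_ge0 (mu a w).
have g0 : nrm (Psi 0 k0) = 0.
  have [D0 PsiD0] := bdd_leg_morph 0.
  by rewrite /k0 (bddB PsiD0) (bddZ PsiD0) Psi1 // leg_morph_start subrr nrm0.
have : nrm (Psi 1 k0) = 0.
  have H := @norm_gap _ (fun t => nrm (Psi t k0)) N (@Psi_cont k0) g0;
    apply: H => t t01 /=.
  rewrite nrm_ge0 /= {1}wE !PsiM //.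
  apply: le_trans (ler_nrmM _ _) _; rewrite mulrC.
  apply: ler_pM; rewrite ?nrm_ge0 ?PsiN // expr2 ler_nrmM //.
move/nrm0_eq0; rewrite /k0 (bddB PsiD) (bddZ PsiD) Psi1 // => /eqP.
by rewrite subr_eq0 => /eqP.
Qed.

End Path.

Theorem theorem2p7 (R : realType)
    (mt : forall A B : cstarType R, minTensor A B)
    (H : cstarType R) (DeltaH : {starmorphism H -> mt H H})
    (cqgH : compact_quantum_group DeltaH)
    (finite_quotient : exists (K : cstarType R)
        (DeltaK : {starmorphism K -> mt K K}) (iota : {starmorphism K -> H}),
      [/\ compact_quantum_group DeltaK, nontrivial K, finite_dimensional K &
          quantum_group_embedding DeltaK DeltaH iota])
    (A : cstarType R) (A_nonzero : (𝟏 : A) <> 0%R) (delta : {starmorphism A -> mt A H})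
    (free_delta : free_coaction DeltaH delta)
    (J : equivariantJoin delta) (deltaJ : {starmorphism J -> mt J H})
    (deltaJP : is_join_coaction DeltaH deltaJ) :
  ~ exists phi : {starmorphism H -> J}, equivariant DeltaH deltaJ phi.
Proof.
move=> [phi [Fphi FphiE phiE]].
have [K [DeltaK [iota [KP Knt Kfd iotaP]]]] := finite_quotient.
have [[delta_inj [F' [G' [alpha' [F'E G'E alpha'E co']]]] _] _] := free_delta.
have [m [f [mu [muB muf fE]]]] := fd_basis mt Kfd.
have [nu [[Cnu nuC] nu1]] := bounded_sep mt A_nonzero.
have AH1 : (𝟏 : mt A H) <> 0.
  rewrite -(star_morph1 (s := delta)) -(bdd0 (bdd_starmorph delta)).
  by move/delta_inj.
have H1 : (𝟏 : H) <> 0.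
  by move=> H10; apply: AH1; rewrite -tens11 H10 linear0r.
have [omega [[Com omC] om1]] := bounded_sep mt H1.
have [v vE] := leg2_inverse KP muB muf fE.
have in0 : (0 : R) \in `[0, 1] by rewrite in_itv /= lexx ler01.
have in1 : (1 : R) \in `[0, 1] by rewrite in_itv /= lexx ler01.
pose phit t : {starmorphism K -> mt A H} := join_ev J t \o (phi \o iota).
pose j := leg_iota mt iota A.
pose psi t i := \sum_(a < m) phit t (f a) ∙ j (v a i).
have phitE t k : phit t k = \sum_(i < m) psi t i ∙ j (leg2 DeltaK mu i k) by exact: vE.
have psi_leg t : t \in `[0, 1] -> forall i, exists y, psi t i = legl (mt A H) y.
  move=> t01; have [F [G [alpha [FE GE alphaE co]]]] := deltaJP _ t01.
  apply: (leg_scalar cqgH KP iotaP muB muf fE GE alphaE _ (phitE t)) => k.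
  rewrite -[phit t k]/(join_ev J t (phi (iota k))) -co phiE.
  rewrite (Delta_iota iotaP muB fE) (bdd_sum (bdd_starmorph Fphi)) (bdd_sum
    (bdd_starmorph F)).
  by congr (alpha _); apply: eq_bigr => a _; rewrite FphiE FE.
have psi_comm t : t \in `[0, 1] -> forall i k, psi t i ∙ j k = j k ∙ psi t i.
  by move=> t01 i k; have [y ->] := psi_leg t t01 i; exact: legs_comm.
have /choice[c cE] : forall i, exists c : R[i], psi 0 i = c *: 𝟏.
  move=> i.
  have [y yE] := psi_leg 0 in0 i.
  (* At [t = 0] the values [phit 0 (f a)] lie in [1 (x) H], as does the image of [j]; so [psi 0 i]
     lies both there and in [A (x) 1], and is scalar. *)
  have [h hE] : exists h, psi 0 i = legr (mt A H) h.
    have : forall a, exists h, phit 0 (f a) = legr (mt A H) h.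
      by move=> a; have [_ p0 _] := join_ev_path (phi (iota (f a))).
    move=> /choice[h hE]; exists (\sum_(a < m) h a ∙ iota (v a i)).
    rewrite (bdd_sum (bdd_starmorph (legr (mt A H)))); apply: eq_bigr => a _.
    by rewrite hE (star_morphM (s := legr (mt A H))).
  by exists (nu y); rewrite hE; apply: (legr_legl_scalar nuC nu1); rewrite -hE.
have PsiM : {in `[0, 1], forall t k l,
    leg_morph mu (psi t) (k ∙ l) = leg_morph mu (psi t) k ∙ leg_morph mu (psi t) l}.
  by move=> t t01; exact: (leg_morphM KP muB (phitE t) (psi_comm t t01)).
have Psi_star : {in `[0, 1], forall t k,
    leg_morph mu (psi t) (star k) = star (leg_morph mu (psi t) k)}.
  by move=> t t01; exact: (leg_morph_star KP muB (phitE t) (psi_comm t t01)).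
have Psi1 : {in `[0, 1], forall t, leg_morph mu (psi t) 𝟏 = 𝟏}.
  by move=> t t01; exact: (leg_morph1 muB (phitE t)).
have Psi_cont k : {within `[0, 1], continuous (fun t => nrm (leg_morph mu (psi t) k))}.
  have E : (fun t => nrm (leg_morph mu (psi t) k)) =
      (fun t => nrm (\sum_(a < m) phit t (f a) ∙ \sum_(i < m) (mu i k : R[i]) *: j (v
        a i))).
    apply/funext => t; congr nrm; rewrite /leg_morph /psi.
    under eq_bigr do rewrite scaler_sumr.
    rewrite exchange_big; apply: eq_bigr => a _; rewrite cmul_sumr; apply: eq_bigr => i _.
    by rewrite cmulZr.
  rewrite E; apply: continuous_nrm_sum => a.
  by have [] := join_ev_path (phi (iota (f a))).
have psi_bound : exists M : R, {in `[0, 1], forall t i, nrm (psi t i) <= M}.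
  (* Only [phit t] varies with [t], and it is contractive. The sum over [i] makes one bound serve
     all indices. *)
  exists (\sum_(i < m) \sum_(a < m) nrm (f a) * nrm (j (v a i))) => t _ i.
  rewrite (bigD1 i) //= -[leLHS]addr0; apply: lerD; last first.
    by apply: sumr_ge0 => b _; apply: sumr_ge0 => a _; rewrite mulr_ge0 ?nrm_ge0.
  apply: le_trans (ler_nrm_sum _ _ _) _; apply: ler_sum => a _.
  apply: le_trans (ler_nrmM _ _) _; rewrite ler_wpM2r ?nrm_ge0 //.
  exact: nrm_starmorph.
pose chi := start_character mu c.
have Psi_end k : leg_morph mu (psi 1) k = (chi k : R[i]) *: 𝟏.
  apply: (leg_morph_end muB PsiM Psi_star Psi1 _ psi_bound AH1 cE) => //.
  exact: (selfadjoint_regular muB muf fE).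
have [C chiC] := bdd_start_character c muB.
have chi1 : chi 𝟏 = 1 := start_character1 Psi1 AH1 cE.
have chiM k l : chi (k ∙ l) = (chi k : R[i]) * (chi l : R[i]) :> R[i].
  exact: (start_characterM PsiM AH1 cE).
apply: (invariant_character_trivial KP chiC chi1 chiM _ Knt).
have psi1 a : psi 1 a = (chi (f a) : R[i]) *: 𝟏.
  rewrite -Psi_end /leg_morph (bigD1 a) //= muf eqxx scale1r big1 ?addr0 // => b ba.
  by rewrite muf (negbTE ba) scale0r.
pose L k := slicel chi (DeltaK k).
have LE k : L k = \sum_(a < m) (chi (f a) : R[i]) *: leg2 DeltaK mu a k.
  have [S SE] := slicelP (mt K K) chiC.
  by rewrite /L {1}(leg2E DeltaK muB fE) (bdd_sum S); apply: eq_bigr => a _; rewrite SE.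
have phi1L k : phit 1 k = j (L k).
  rewrite phitE LE (bdd_sum (bdd_starmorph j)); apply: eq_bigr => a _.
  by rewrite psi1 cmulZl cmul1l (bddZ (bdd_starmorph j)).
(* At [t = 1], [𝟏 \ox iota (L k)] equals some [delta a]. In the coaction identity at [a], one side
   applies [delta] to [𝟏] and the other applies [DeltaH] to [iota (L k)]. *)
have DL k : DeltaH (iota (L k)) = 𝟏 \ox iota (L k).
  have [_ _ [a aE]] := join_ev_path (phi (iota k)).
  have daE : delta a = 𝟏 \ox iota (L k) by rewrite -aE -[LHS]/(phit 1 k) phi1L.
  have := co' a; rewrite daE F'E G'E (star_morph1 (s := delta)) -(tens11 (mt A H))
    alpha'E.
  by move/esym/(legr_inj nuC nu1).
have iL k : iota (L k) = \sum_(b < m) (chi (f b) : R[i]) *: iota (leg2 DeltaK mu b k).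
  rewrite LE (bdd_sum (bdd_starmorph iota)); apply: eq_bigr => b _.
  exact: bddZ (bdd_starmorph iota) _ _.
(* Both sides of [DL k] are combinations of the second legs [iota (leg2 DeltaK mu b k)], with first
   legs [iota (L (f b))] and [chi (f b)] respectively; cancellation equates the first legs. *)
have Lf b : L (f b) = (chi (f b) : R[i]) *: 𝟏.
  have [iota_inj _] := iotaP; apply: iota_inj; apply: (legl_inj (T := mt H H) omC om1).
  move: b; apply: (leg2_eq KP muB muf (j := leg_iota mt iota H)) => k.
  transitivity (DeltaH (iota (L k))).
    rewrite [in RHS]iL (bdd_sum (bdd_starmorph DeltaH)).
    under [RHS]eq_bigr do
      rewrite (bddZ (bdd_starmorph DeltaH)) (Delta_iota_leg KP iotaP muB fE) scaler_sumr.
    rewrite [RHS]exchange_big; apply: eq_bigr => b _.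
    rewrite -[leg_iota _ _ _ _]/(legr (mt H H) (iota (leg2 DeltaK mu b k)))
      -tens_legs iL linear_sumlz.
    by apply: eq_bigr => a _; rewrite linearZl_LR.
  rewrite DL iL linear_sumr; apply: eq_bigr => b _.
  rewrite linearZr_LR (bddZ (bdd_starmorph iota)) (bddZ (bdd_starmorph (legl (mt H H)))).
  by rewrite !star_morph1 cmulZl cmul1l.
move=> k; rewrite -/(L k).
have [S _] := slicelP (mt K K) chiC.
have LB := bdd_comp (bdd_starmorph DeltaK) S.
rewrite [in LHS](fE k) -[L _]/((slicel chi \o DeltaK) _) (bdd_sum LB).
rewrite [in RHS](fE k) (bdd_sum chiC) scaler_suml; apply: eq_bigr => b _.
by rewrite (bddZ LB) -[(_ \o _) _]/(L (f b)) Lf (bddZ chiC) scalerA.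
Qed.
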